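(* Let $R$ be a left Ore domain and let $A=R[x_1;\sigma_1]\cdots[x_n;\sigma_n]$ be a quasi-commutative skew PBW extension of $R$. Then $A$ is a left Ore domain; hence $A$ has a left total division ring of fractions, and $$Q_l(A)\cong Q_l\big(Q_l(R)[x_1;\overline{\sigma}_1]\cdots[x_n;\overline{\sigma}_n]\big).$$ If $R$ is a right Ore domain and $\sigma_i$ is bijective for every $1\le i\le n$, then $A$ is a right Ore domain and $$Q_d(A)\cong Q_d\big(Q_d(R)[x_1;\widetilde{\sigma}_1]\cdots[x_n;\widetilde{\sigma}_n]\big).$$
   Context: Rings are associative with identity. Quasi-commutative skew PBW extension. A ring $A\supseteq R$ is a quasi-commutative skew PBW extension of $R$ if: - there are $x_1,\dots,x_n\in A$ such that $A$ is a free left $R$-module with basis $\{x_1^{\alpha_1}\cdots x_n^{\alpha_n}:\alpha\in\mathbb N^n\}$; - for each $i$ and $r\in R\setminus\{0\}$ there is $c_{i,r}\in R\setminus\{0\}$ with $x_ir=c_{i,r}x_i$; - for all $i,j$ there is $c_{i,j}\in R\setminus\{0\}$ with $x_jx_i=c_{i,j}x_ix_j$. Such an $A$ is identified with an iterated skew polynomial ring of endomorphism type $R[x_1;\sigma_1]\cdots[x_n;\sigma_n]$. Here each $\sigma_i$ is an injective endomorphism of $B_{i-1}:=R[x_1;\sigma_1]\cdots[x_{i-1};\sigma_{i-1}]$ (with $B_0=R$) with $\sigma_i(R)\subseteq R$, and $x_ib=\sigma_i(b)x_i$ for $b\in B_{i-1}$. In $B[x;\sigma]$, elements are left $B$-combinations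 of powers of $x$ and $xb=\sigma(b)x$. Left-side maps. Let $S=R\setminus\{0\}$. The localization $S^{-1}B_{i-1}$ is identified with $Q_l(R)[x_1;\overline\sigma_1]\cdots[x_{i-1};\overline\sigma_{i-1}]$; every element can be written $\frac{a}{s}=s^{-1}a$ with $a\in B_{i-1}$, $s\in S$. Then $\overline{\sigma}_i(\frac{a}{s}):=\frac{\sigma_i(a)}{\sigma_i(s)}$. Right-side maps. $\widetilde\sigma_i$ is defined the same way on right fractions $\frac{a}{s}=as^{-1}$, with $Q_d(R)$ in place of $Q_l(R)$. Left/right Ore domains: domains satisfying the left/right Ore condition with respect to all nonzero elements. $Q_l$ and $Q_d$ denote left and right total division rings of fractions. *)

(* Defs.v *)
From HB Require Import structures.
From mathcomp Require Import all_boot all_order all_algebra.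
Set Implicit Arguments. Unset Strict Implicit. Unset Printing Implicit Defensive.
Import GRing.Theory.
Local Open Scope ring_scope.

(* no zero divisors (nzRingType already has 1 != 0) *)
Definition domain (T : nzRingType) : Prop :=
  forall a b : T, a * b = 0 -> a = 0 \/ b = 0.

Definition left_Ore (T : nzRingType) : Prop :=
  forall a s : T, s != 0 -> exists b t : T, t != 0 /\ t * a = b * s.

Definition right_Ore (T : nzRingType) : Prop :=
  forall a s : T, s != 0 -> exists b t : T, t != 0 /\ a * t = s * b.

Definition left_Ore_domain (T : nzRingType) : Prop := domain T /\ left_Ore T.
Definition right_Ore_domain (T : nzRingType) : Prop := domain T /\ right_Ore T.

Definition division_ring (D : unitRingType) : Prop :=
  forall d : D, d != 0 -> d \is a GRing.unit.

Definition left_fractions (T : nzRingType) (Q : unitRingType)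
  (f : {rmorphism T -> Q}) : Prop :=
  division_ring Q /\ injective f /\
  forall q : Q, exists s a : T, s != 0 /\ q = (f s)^-1 * f a.

Definition right_fractions (T : nzRingType) (Q : unitRingType)
  (f : {rmorphism T -> Q}) : Prop :=
  division_ring Q /\ injective f /\
  forall q : Q, exists s a : T, s != 0 /\ q = f a * (f s)^-1.

Definition ring_iso (Q Q' : nzRingType) : Prop :=
  exists g : {rmorphism Q -> Q'}, bijective g.

Definition mexp (n : nat) := {ffun 'I_n -> nat}.

Definition monomial (T : nzRingType) (n : nat) (x : 'I_n -> T) (a : mexp n) : T :=
  \prod_(i < n) x i ^+ a i.

Definition lcomb (R T : nzRingType) (f : R -> T) (n : nat) (x : 'I_n -> T)
  (s : seq (mexp n)) (c : mexp n -> R) : T :=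
  \sum_(a <- s) f (c a) * monomial x a.

Definition left_monomial_basis (R T : nzRingType) (f : R -> T) (n : nat)
  (x : 'I_n -> T) : Prop :=
  (forall t : T, exists (s : seq (mexp n)) (c : mexp n -> R), t = lcomb f x s c) /\
  (forall (s : seq (mexp n)) (c : mexp n -> R), uniq s -> lcomb f x s c = 0 -> forall a, a \in s -> c a = 0).

Definition qc_skew_PBW (R A : nzRingType) (iota : {rmorphism R -> A})
  (n : nat) (x : 'I_n -> A) : Prop :=
  [/\ injective iota,
      left_monomial_basis iota x,
      (forall (i : 'I_n) (r : R), r != 0 ->
          exists c : R, c != 0 /\ x i * iota r = iota c * x i)
    & (forall i j : 'I_n, exists c : R, c != 0 /\
          x j * x i = iota c * x i * x j)].

(* b lies in B_{i-1} = R[x_1;s_1]...[x_{i-1};s_{i-1}] (0-based: generated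
   over R by the x j with j < i) *)
Definition in_Bsub (R A : nzRingType) (iota : {rmorphism R -> A})
  (n : nat) (x : 'I_n -> A) (i : nat) (b : A) : Prop :=
  exists (s : seq (mexp n)) (c : mexp n -> R),
    (forall a, a \in s -> forall j : 'I_n, (i <= j)%N -> a j = 0%N) /\
              b = lcomb iota x s c.

(* sigma_i (defined on B_{i-1} by x_i b = sigma_i(b) x_i) is onto B_{i-1}
   (it is an injective endomorphism by definition, so this is bijectivity) *)
Definition sigma_bijective (R A : nzRingType) (iota : {rmorphism R -> A})
  (n : nat) (x : 'I_n -> A) (i : 'I_n) : Prop :=
  forall b', in_Bsub iota x i b' ->
    exists b, in_Bsub iota x i b /\ x i * b = b' * x i.

(* B = K[y_1; sbar_1]...[y_n; sbar_n] where (K, phi) = Q_l(R), presented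
   (like A) as quasi-commutative PBW extension of K via psi:
   sbar_i (s^-1 a) = sigma_i(s)^-1 sigma_i(a) on K, and
   sbar_i (y_j) = sigma_i(x_j) = c_{j,i} y_j on the variables. *)
Definition left_bar_extension (R A : nzRingType) (iota : {rmorphism R -> A})
  (n : nat) (x : 'I_n -> A) (K : unitRingType) (phi : {rmorphism R -> K})
  (B : nzRingType) (psi : {rmorphism K -> B}) (y : 'I_n -> B) : Prop :=
  [/\ injective psi,
      left_monomial_basis psi y,
      (forall (i : 'I_n) (s a s' a' : R), s != 0 ->
          x i * iota s = iota s' * x i -> x i * iota a = iota a' * x i ->
          y i * psi ((phi s)^-1 * phi a) = psi ((phi s')^-1 * phi a') * y i)
    & (forall (i j : 'I_n) (c : R), x j * x i = iota c * x i * x j ->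
          y j * y i = psi (phi c) * y i * y j)].

(* right version: (K, phi) = Q_d(R), stilde_i (a s^-1) = sigma_i(a) sigma_i(s)^-1 *)
Definition right_tilde_extension (R A : nzRingType) (iota : {rmorphism R -> A})
  (n : nat) (x : 'I_n -> A) (K : unitRingType) (phi : {rmorphism R -> K})
  (B : nzRingType) (psi : {rmorphism K -> B}) (y : 'I_n -> B) : Prop :=
  [/\ injective psi,
      left_monomial_basis psi y,
      (forall (i : 'I_n) (s a s' a' : R), s != 0 ->
          x i * iota s = iota s' * x i -> x i * iota a = iota a' * x i ->
          y i * psi (phi a * (phi s)^-1) = psi (phi a' * (phi s')^-1) * y i)
    & (forall (i j : 'I_n) (c : R), x j * x i = iota c * x i * x j ->
          y j * y i = psi (phi c) * y i * y j)].

(* Main.v *)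
(* Over a left Ore domain R the monomials x^a multiply up to nonzero scalars, so
   leading terms for a monomial order multiply and A is a domain. A is left Ore
   by counting: the monomials with exponents below m number m^n, and their
   products with two fixed elements lie in the span of (m+d)^n monomials; for
   large m this gives 2m^n > (m+d)^n vectors, which are dependent over R. The
   right-hand statement is the left-hand one for the converse ring: bijectivity
   of the sigma_i makes the x^a a basis of A on the other side as well.
   Finally, the pairs (x_i, y_i) generate the graph of an embedding of A into
   the extension of Q(R), each of whose elements is a fraction of elements of A
   with a denominator in R; so both rings have the same ring of fractions. *)
Require Import Defs.
From HB Require Import structures.
From mathcomp Require Import all_boot all_order all_algebra.
From Stdlib Require Import ClassicalEpsilon.
Import GRing.Theory.
Local Open Scope ring_scope.
Local Open Scope quotient_scope.
Set Implicit Arguments. Unset Strict Implicit. Unset Printing Implicit Defensive.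

(** Scalars pass a monomial only after a twist, and a pivot in [R] cannot be inverted, so the
    dependence behind the counting is found by elimination in which the Ore condition replaces
    division. It produces enough vectors because [(m + d)^n / m^n] tends to 1 and so drops below 2.
    Passing to the converse ring reverses words, so the [x^a] are no longer monomials in the
    prescribed order; the argument therefore runs on an abstract family [X a] indexed by exponents,
    of which only twisting, multiplication up to nonzero scalars, spanning and freeness are kept.
    Existence of the rings of fractions is part of the claim, so they are constructed: a fraction
    [q] is handled as the partial map [t |-> t q]. Both the comparison of two rings of fractions and
    the embedding of [A] come from relations closed under the ring operations, where being well
    defined only has to be checked over [0]. *)

Lemma graph_morphism (A B : nzRingType) (G : A -> B -> Prop) :
  G 1 1 ->
  (forall a b a' b', G a b -> G a' b' -> G (a - a') (b - b')) ->
  (forall a b a' b', G a b -> G a' b' -> G (a * a') (b * b')) ->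
  (forall a, exists b, G a b) -> (forall b, G 0 b -> b = 0) ->
  exists h : {rmorphism A -> B}, forall a, G a (h a).
Proof.
move=> G1 GB GM Gtot G0.
pose h a := proj1_sig (constructive_indefinite_description _ (Gtot a)).
have Gh a : G a (h a) by rewrite /h; case: constructive_indefinite_description.
(* Compatibility with differences reduces single-valuedness to the fibre over [0]. *)
have Guniq a b b' : G a b -> G a b' -> b = b'.
  by move=> Gb Gb'; apply/subr0_eq/G0; rewrite -(subrr a); apply: GB.
have hB : zmod_morphism h.
  by move=> a a'; apply: (Guniq (a - a')); [apply: Gh | apply: GB; apply: Gh].
have hM : monoid_morphism h.
  split=> [|a a']; first exact: Guniq (Gh 1) G1.
  by apply: (Guniq (a * a')); [apply: Gh | apply: GM; apply: Gh].
pose M1 := GRing.isZmodMorphism.Build A B h hB.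
pose M2 := GRing.isMonoidMorphism.Build A B h hM.
pose H : {rmorphism A -> B} := HB.pack h M1 M2.
by exists H.
Qed.

(** * Converse rings: right-hand notions as left-hand ones *)

Section Converse.
Variables (S T : nzRingType) (f : {rmorphism S -> T}).

Definition conv_fun : S^c -> T^c := f.
Fact conv_fun_is_zmod : zmod_morphism conv_fun.
Proof. by move=> a b; apply: (rmorphB f). Qed.
Fact conv_fun_is_monoid : monoid_morphism conv_fun.
Proof. by split=> [|a b]; [apply: (rmorph1 f) | apply: (rmorphM f b a)]. Qed.
HB.instance Definition _ :=
  GRing.isZmodMorphism.Build S^c T^c conv_fun conv_fun_is_zmod.
HB.instance Definition _ :=
  GRing.isMonoidMorphism.Build S^c T^c conv_fun conv_fun_is_monoid.
Definition conv_morph : {rmorphism S^c -> T^c} := conv_fun.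
End Converse.

Lemma right_Ore_domainP (T : nzRingType) :
  right_Ore_domain T <-> left_Ore_domain T^c.
Proof.
split=> -[Tdom TOre]; split.
- by move=> a b ab0; have [] := Tdom b a ab0; auto.
- exact: TOre.
- by move=> a b ab0; have [] := Tdom b a ab0; auto.
- exact: TOre.
Qed.

Lemma right_fractionsP (T : nzRingType) (Q : unitRingType)
    (f : {rmorphism T -> Q}) :
  right_fractions f <-> left_fractions (conv_morph f : {rmorphism T^c -> Q^c}).
Proof. by split=> -[Qdiv [finj fQ]]; split. Qed.

Lemma ring_iso_conv (S T : nzRingType) : ring_iso S^c T^c -> ring_iso S T.
Proof.
case=> g g_bij.
pose g0 : S -> T := g.
have gB : zmod_morphism g0 by move=> a b; apply: (rmorphB g).
have gM : monoid_morphism g0.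
  by split=> [|a b]; [apply: (rmorph1 g) | apply: (rmorphM g b a)].
pose M1 := GRing.isZmodMorphism.Build S T g0 gB.
pose M2 := GRing.isMonoidMorphism.Build S T g0 gM.
pose h : {rmorphism S -> T} := HB.pack g0 M1 M2.
by exists h.
Qed.

(** * Ore localization *)

Section OreLocalization.
Variables (T : nzRingType) (T_Ore : left_Ore_domain T).

Lemma domain_mulf_neq0 (a b : T) : a != 0 -> b != 0 -> a * b != 0.
Proof.
move=> /eqP a0 /eqP b0; apply/eqP => ab0.
by case: T_Ore => /(_ _ _ ab0) [].
Qed.

Lemma domain_mulIf (s : T) : s != 0 -> injective ( *%R^~ s).
Proof.
move=> /eqP s0 a b /= /eqP; rewrite -subr_eq0 -mulrBl => /eqP.
by case/(proj1 T_Ore) => // /eqP; rewrite subr_eq0 => /eqP.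
Qed.

Lemma domain_mulfI (s : T) : s != 0 -> injective ( *%R s).
Proof.
move=> /eqP s0 a b /= /eqP; rewrite -subr_eq0 -mulrBr => /eqP.
by case/(proj1 T_Ore) => // /eqP; rewrite subr_eq0 => /eqP.
Qed.

Lemma Ore_mult (s a : T) : s != 0 -> exists u v : T, u != 0 /\ u * a = v * s.
Proof. by move=> s0; have [v [u ?]] := proj2 T_Ore a s s0; exists u, v. Qed.

(* A pair [(s, a)] stands for the fraction [s^-1 a]. *)
Definition prefrac := {p : T * T | p.1 != 0}.

(* [pact p t y] says that [t * (s^-1 a) = y] for [p = (s, a)]. All ring
   operations are defined by their effect on a common multiplier [t]. *)
Definition pact (p : prefrac) (t y : T) : Prop :=
  exists u v, [/\ u != 0, u * t = v * (val p).1 & u * y = v * (val p).2].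

Lemma pact_self (p : prefrac) : pact p (val p).1 (val p).2.
Proof. by exists 1, 1; rewrite oner_neq0. Qed.

(** A common multiple [w * u = w' * u'] of the two multipliers also gives [w * v = w' * v'], by
    cancelling the denominator of [p]; then [w * u] cancels in front of [y] and [y']. *)
Lemma pact_fun p t y y' : pact p t y -> pact p t y' -> y = y'.
Proof.
case=> [u [v [u0 ut uy]]] [u' [v' [u'0 ut' uy']]].
have [w [w' [w0 wu]]] := Ore_mult u u'0.
have w'0 : w' != 0.
  apply: contraNneq (domain_mulf_neq0 w0 u0) => w'0.
  by rewrite wu w'0 mul0r.
have wv : w * v = w' * v'.
  by apply: (domain_mulIf (valP p)); rewrite -!mulrA -ut -ut' !mulrA wu.
apply: (domain_mulfI (domain_mulf_neq0 w0 u0)).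
by rewrite -mulrA uy wu -mulrA uy' !mulrA wv.
Qed.

Lemma pact_scale p r t y : pact p t y -> pact p (r * t) (r * y).
Proof.
case=> [u [v [u0 ut uy]]].
have [w [w' [w0 wr]]] := Ore_mult r u0.
by exists w, (w' * v); rewrite -!mulrA -ut -uy !mulrA -wr.
Qed.

Lemma pact_cancel p r t y : r != 0 -> pact p (r * t) (r * y) -> pact p t y.
Proof.
move=> r0 [u [v [u0 ut uy]]]; exists (u * r), v.
by rewrite -!mulrA domain_mulf_neq0.
Qed.

(** The Ore condition for partial maps: the domain of [p] meets every nonzero left ideal [T w]. This
    is the source of common multipliers for several fractions. *)
Lemma pact_dom p w : exists u y, u != 0 /\ pact p (u * w) y.
Proof.
have [u [v [u0 uw]]] := Ore_mult w (valP p).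
by exists u, (v * (val p).2); split=> //; rewrite uw; apply/pact_scale/pact_self.
Qed.

Lemma pact_D p t y t' y' :
  pact p t y -> pact p t' y' -> pact p (t + t') (y + y').
Proof.
case=> [u [v [u0 ut uy]]] [u' [v' [u'0 ut' uy']]].
have [w [w' [w0 wu]]] := Ore_mult u u'0.
exists (w * u), (w * v + w' * v'); split; first exact: domain_mulf_neq0.
  by rewrite mulrDr mulrDl {2}wu -!mulrA ut ut'.
by rewrite mulrDr mulrDl {2}wu -!mulrA uy uy'.
Qed.

Definition frac_eq (p p' : prefrac) : Prop :=
  exists t y, [/\ t != 0, pact p t y & pact p' t y].

(** One common value at a nonzero [t] suffices: the Ore condition turns any [t'] into
    [u * t' = v * t], where both values are known, and [u] cancels. *)
Lemma frac_eqP p p' : frac_eq p p' <-> (forall t y, pact p t y <-> pact p' t y).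
Proof.
split=> [[t [y [t0 py py']]] | eqp].
  have half q q' : pact q t y -> pact q' t y ->
      forall t' y', pact q t' y' -> pact q' t' y'.
    move=> qy qy' t' y' qt'; have [u [v [u0 ut]]] := Ore_mult t' t0.
    apply: (pact_cancel u0); rewrite ut.
    suff -> : u * y' = v * y by apply: pact_scale.
    apply: (@pact_fun q (u * t')); first exact: pact_scale.
    by rewrite ut; apply: pact_scale.
  by move=> t' y'; split; apply: half.
exists (val p).1, (val p).2; split; first exact: valP p.
  exact: pact_self.
by apply/eqp/pact_self.
Qed.

(** The quotient construction takes a boolean relation, hence the classical decision. *)
Definition frac_eqb (p p' : prefrac) : bool :=
  if excluded_middle_informative (frac_eq p p') then true else false.

Lemma frac_eqbP p p' : reflect (frac_eq p p') (frac_eqb p p').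
Proof.
by rewrite /frac_eqb; case: excluded_middle_informative => H; constructor.
Qed.

Lemma frac_eqb_equiv : equiv_class_of frac_eqb.
Proof.
split=> [p|p q|q p r].
- by apply/frac_eqbP/frac_eqP.
- by apply/frac_eqbP/frac_eqbP => -[t [y [? ? ?]]]; exists t, y.
- move=> /frac_eqbP/frac_eqP pq /frac_eqbP/frac_eqP qr.
  by apply/frac_eqbP/frac_eqP => t y; rewrite pq qr.
Qed.

Canonical frac_equiv := EquivRelPack frac_eqb_equiv.
Definition frac : Type := {eq_quot frac_equiv}.
HB.instance Definition _ := Choice.on frac.
HB.instance Definition _ := EqQuotient.on frac.

Definition act (q : frac) (t y : T) : Prop := pact (repr q) t y.

Lemma act_fun q t y y' : act q t y -> act q t y' -> y = y'.
Proof. exact: pact_fun. Qed.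
Lemma act_scale r q t y : act q t y -> act q (r * t) (r * y).
Proof. exact: pact_scale. Qed.
Lemma act_cancel r q t y : r != 0 -> act q (r * t) (r * y) -> act q t y.
Proof. exact: pact_cancel. Qed.
Lemma act_dom q w : exists u y, u != 0 /\ act q (u * w) y.
Proof. exact: pact_dom. Qed.
Lemma act_D q t y t' y' : act q t y -> act q t' y' -> act q (t + t') (y + y').
Proof. exact: pact_D. Qed.
Lemma act_self q : exists t y, t != 0 /\ act q t y.
Proof. by have [u [y]] := act_dom q 1; rewrite mulr1; exists u, y. Qed.

(** The ring axioms below rest on this: both sides are evaluated at one nonzero multiplier where all
    operands act. *)
Lemma act_ext q q' t y : t != 0 -> act q t y -> act q' t y -> q = q'.
Proof.
move=> t0 qy qy'; rewrite -[q]reprK -[q']reprK; apply/eqP; rewrite eqmodE.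
by apply/frac_eqbP; exists t, y.
Qed.

Lemma fracP (s a : T) : s != 0 -> exists q, act q s a.
Proof.
move=> s0; pose p : prefrac := exist _ (s, a) s0; exists (\pi p).
suff /frac_eqP eqp : frac_eq (repr (\pi p : frac)) p by apply/eqp/(pact_self p).
apply/frac_eqbP; rewrite -[frac_eqb _ _]/(frac_equiv _ _) -eqmodE.
by rewrite reprK.
Qed.

Lemma frac_add_ex q q' : exists r, forall t y y',
  act q t y -> act q' t y' -> act r t (y + y').
Proof.
have [t1 [y1 [t10 qy1]]] := act_self q.
have [u [y2 [u0 qy2]]] := act_dom q' t1.
have ut0 := domain_mulf_neq0 u0 t10.
have [r rP] := fracP (u * y1 + y2) ut0; exists r => t y y' qy qy'.
have [w [v [w0 wt]]] := Ore_mult t ut0.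
apply: (act_cancel w0); rewrite wt.
suff -> : w * (y + y') = v * (u * y1 + y2) by apply: act_scale.
rewrite !mulrDr; congr (_ + _).
  apply: (@act_fun q (w * t)); first exact: act_scale.
  by rewrite wt; do 2!apply: act_scale.
by apply: (@act_fun q' (w * t)); [|rewrite wt]; apply: act_scale.
Qed.

(** Multiplication composes the partial maps, [q] first. The value at [u * t1] fixes the product,
    and the Ore condition carries it to every other [t]. *)
Lemma frac_mul_ex q q' : exists r, forall t y z,
  act q t y -> act q' y z -> act r t z.
Proof.
have [t1 [y1 [t10 qy1]]] := act_self q.
have [u [z1 [u0 qz1]]] := act_dom q' y1.
have ut0 := domain_mulf_neq0 u0 t10.
have [r rP] := fracP z1 ut0; exists r => t y z qy qz.
have [w [v [w0 wt]]] := Ore_mult t ut0.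
apply: (act_cancel w0); rewrite wt.
suff -> : w * z = v * z1 by apply: act_scale.
apply: (@act_fun q' (w * y)); first exact: act_scale.
suff -> : w * y = v * (u * y1) by apply: act_scale.
by apply: (@act_fun q (w * t)); [|rewrite wt; apply: act_scale]; apply: act_scale.
Qed.

Definition frac_add q q' : frac :=
  proj1_sig (constructive_indefinite_description _ (frac_add_ex q q')).
Lemma act_add q q' t y y' :
  act q t y -> act q' t y' -> act (frac_add q q') t (y + y').
Proof.
by rewrite /frac_add; case: constructive_indefinite_description => r; apply.
Qed.

Definition frac_mul q q' : frac :=
  proj1_sig (constructive_indefinite_description _ (frac_mul_ex q q')).
Lemma act_mul q q' t y z :
  act q t y -> act q' y z -> act (frac_mul q q') t z.
Proof.
by rewrite /frac_mul; case: constructive_indefinite_description => r; apply.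
Qed.

Lemma frac_const_ex a : exists q, forall t, act q t (t * a).
Proof.
have [q qP] := fracP a (oner_neq0 T); exists q => t.
by rewrite -{1}[t]mulr1; apply: act_scale.
Qed.

Definition frac_const a : frac :=
  proj1_sig (constructive_indefinite_description _ (frac_const_ex a)).
Lemma act_const a t : act (frac_const a) t (t * a).
Proof. by rewrite /frac_const; case: constructive_indefinite_description. Qed.

Definition frac_opp q : frac := frac_mul q (frac_const (- 1)).
Lemma act_opp q t y : act q t y -> act (frac_opp q) t (- y).
Proof. by move=> qy; rewrite -mulrN1; apply/(act_mul qy)/act_const. Qed.

Lemma act_0 t : act (frac_const 0) t 0.
Proof. by rewrite -{2}(mulr0 t); apply: act_const. Qed.
Lemma act_1 t : act (frac_const 1) t t.
Proof. by rewrite -{2}(mulr1 t); apply: act_const. Qed.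

Lemma act_dom2 q q' : exists t y y', [/\ t != 0, act q t y & act q' t y'].
Proof.
have [t [y [t0 qy]]] := act_self q; have [u [y' [u0 qy']]] := act_dom q' t.
exists (u * t), (u * y), y'; rewrite domain_mulf_neq0 //.
by split=> //; apply: act_scale.
Qed.

Lemma act_chain q q' : exists t y z, [/\ t != 0, act q t y & act q' y z].
Proof.
have [t [y [t0 qy]]] := act_self q; have [u [z [u0 qz]]] := act_dom q' y.
exists (u * t), (u * y), z; rewrite domain_mulf_neq0 //.
by split=> //; apply: act_scale.
Qed.

Lemma frac_addA : associative frac_add.
Proof.
move=> q1 q2 q3; have [t [y1 [y2 [t0 a1 a2]]]] := act_dom2 q1 q2.
have [u [y3 [u0 a3]]] := act_dom q3 t.
move/(act_scale u): a1 => a1; move/(act_scale u): a2 => a2.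
apply: (act_ext (domain_mulf_neq0 u0 t0)).
  by apply: act_add a1 _; apply: act_add a2 a3.
by rewrite addrA; apply: act_add a3; apply: act_add a1 a2.
Qed.

Lemma frac_addC : commutative frac_add.
Proof.
move=> q1 q2; have [t [y1 [y2 [t0 a1 a2]]]] := act_dom2 q1 q2.
by apply: (act_ext t0 (act_add a1 a2)); rewrite addrC; apply: act_add.
Qed.

Lemma frac_add0 : left_id (frac_const 0) frac_add.
Proof.
move=> q; have [t [y [t0 a]]] := act_self q.
by apply: (act_ext t0 _ a); rewrite -[y]add0r; apply/(act_add _ a)/act_0.
Qed.

Lemma frac_addN : left_inverse (frac_const 0) frac_opp frac_add.
Proof.
move=> q; have [t [y [t0 a]]] := act_self q.
by apply: (act_ext t0 _ (act_0 t)); rewrite -(addNr y); apply: act_add (act_opp a) a.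
Qed.

HB.instance Definition _ :=
  GRing.isZmodule.Build frac frac_addA frac_addC frac_add0 frac_addN.

Lemma frac_mulA : associative frac_mul.
Proof.
move=> q1 q2 q3; have [t [y [z [t0 a1 a2]]]] := act_chain q1 q2.
have [u [w [u0 a3]]] := act_dom q3 z.
move/(act_scale u): a1 => a1; move/(act_scale u): a2 => a2.
apply: (act_ext (domain_mulf_neq0 u0 t0)).
  by apply: act_mul a1 _; apply: act_mul a2 a3.
by apply: act_mul a3; apply: act_mul a1 a2.
Qed.

Lemma frac_mul1l : left_id (frac_const 1) frac_mul.
Proof.
move=> q; have [t [y [t0 a]]] := act_self q.
by apply: (act_ext t0 _ a); apply/act_mul/a/act_1.
Qed.

Lemma frac_mul1r : right_id (frac_const 1) frac_mul.
Proof.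
move=> q; have [t [y [t0 a]]] := act_self q.
by apply: (act_ext t0 _ a); apply/(act_mul a)/act_1.
Qed.

Lemma frac_mulDl : left_distributive frac_mul frac_add.
Proof.
move=> q1 q2 q3; have [t [y1 [y2 [t0 a1 a2]]]] := act_dom2 q1 q2.
have [u [z1 [u0 b1]]] := act_dom q3 y1.
(* [q3] has to act on both values, so [v] is added for [y2] after [u] has served [y1]. *)
have [v [z2 [v0 b2]]] := act_dom q3 (u * y2).
move/(act_scale u)/(act_scale v): a1 => a1.
move/(act_scale u)/(act_scale v): a2 => a2.
move/(act_scale v): b1 => b1.
apply: (@act_ext _ _ (v * (u * t)) (v * z1 + z2)).
- by rewrite !domain_mulf_neq0.
- by apply: act_mul (act_add a1 a2) _; apply: act_D.
- by apply: act_add; [apply: act_mul a1 b1 | apply: act_mul a2 b2].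
Qed.

Lemma frac_mulDr : right_distributive frac_mul frac_add.
Proof.
move=> q1 q2 q3; have [t [y [z2 [t0 a1 a2]]]] := act_chain q1 q2.
have [u [z3 [u0 a3]]] := act_dom q3 y.
move/(act_scale u): a1 => a1; move/(act_scale u): a2 => a2.
apply: (act_ext (domain_mulf_neq0 u0 t0)).
  by apply: act_mul a1 _; apply: act_add a2 a3.
by apply: act_add; [apply: act_mul a1 a2 | apply: act_mul a1 a3].
Qed.

Lemma frac_const_inj : injective frac_const.
Proof.
move=> a b ab; have := act_const a 1; rewrite ab => /act_fun/(_ (act_const b 1)).
by rewrite !mul1r.
Qed.

Lemma frac_1_neq0 : frac_const 1 != 0 :> frac.
Proof. by apply/eqP => /frac_const_inj/eqP; rewrite oner_eq0. Qed.

HB.instance Definition _ := GRing.Zmodule_isNzRing.Build frac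
  frac_mulA frac_mul1l frac_mul1r frac_mulDl frac_mulDr frac_1_neq0.

(** Inversion swaps the values: [q] sends [t] to [y], [r] sends [y] to [t]. The branch [r = q] for
    [q = 0] is the convention that inversion fixes non-units. *)
Lemma frac_inv_ex (q : frac) :
  exists r : frac, if q != 0 then forall t y, act q t y -> act r y t else r = q.
Proof.
have [->|q0] := eqVneq q 0; first by exists 0.
have [t [y [t0 a]]] := act_self q.
have y0 : y != 0.
  by apply: contraNneq q0 => y0; apply/eqP/(act_ext t0 a); rewrite y0; apply: act_0.
have [r rP] := fracP t y0; exists r => t' y' a'.
have [u [v [u0 ut]]] := Ore_mult t' t0.
apply: (act_cancel u0).
suff -> : u * y' = v * y by rewrite ut; apply: act_scale.
by apply: (@act_fun q (u * t')); [|rewrite ut]; apply: act_scale.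
Qed.

Definition frac_inv q : frac :=
  proj1_sig (constructive_indefinite_description _ (frac_inv_ex q)).
Lemma act_inv q t y : q != 0 -> act q t y -> act (frac_inv q) y t.
Proof.
rewrite /frac_inv; case: constructive_indefinite_description => r /= rP q0.
by rewrite q0 in rP; apply: rP.
Qed.

Lemma frac_mulVq : {in [pred q : frac | q != 0], left_inverse 1 frac_inv *%R}.
Proof.
move=> q /= q0; have [t [y [t0 a]]] := act_self q.
apply: (@act_ext _ _ y y); last exact: act_1.
  by apply: contraNneq q0 => y0; apply/eqP/(act_ext t0 a); rewrite y0; apply: act_0.
by apply/act_mul/a/act_inv.
Qed.

Lemma frac_mulqV : {in [pred q : frac | q != 0], right_inverse 1 frac_inv *%R}.
Proof.
move=> q /= q0; have [t [y [t0 a]]] := act_self q.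
by apply: (act_ext t0 _ (act_1 t)); apply/(act_mul a)/act_inv.
Qed.

Lemma frac_unitP (q r : frac) :
  r * q = 1 /\ q * r = 1 -> q \in [pred q : frac | q != 0].
Proof.
case=> rq _; rewrite inE; apply: contra_eq_neq rq => ->.
by rewrite mulr0 eq_sym oner_neq0.
Qed.

Lemma frac_inv_out : {in [predC [pred q : frac | q != 0]], frac_inv =1 id}.
Proof.
move=> q; rewrite !inE negbK /frac_inv => q0.
by case: constructive_indefinite_description => r /=; rewrite q0.
Qed.

HB.instance Definition _ := GRing.NzRing_hasMulInverse.Build frac
  frac_mulVq frac_mulqV frac_unitP frac_inv_out.

Lemma frac_const_is_zmod : zmod_morphism (frac_const : T -> frac).
Proof.
move=> a b; apply: (act_ext (oner_neq0 T) (act_const _ 1)); rewrite mulrBr.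
by apply: act_add (act_const a 1) (act_opp (act_const b 1)).
Qed.

Lemma frac_const_is_monoid : monoid_morphism (frac_const : T -> frac).
Proof.
split=> // a b; apply: (act_ext (oner_neq0 T) (act_const _ 1)); rewrite mulrA.
exact: act_mul (act_const a 1) (act_const b _).
Qed.

HB.instance Definition _ :=
  GRing.isZmodMorphism.Build T frac frac_const frac_const_is_zmod.
HB.instance Definition _ :=
  GRing.isMonoidMorphism.Build T frac frac_const frac_const_is_monoid.

Lemma frac_const_left_fractions :
  left_fractions (frac_const : {rmorphism T -> frac}).
Proof.
split=> [q q0 //|]; split=> [|q]; first exact: frac_const_inj.
have [s [a [s0 qa]]] := act_self q; exists s, a; split=> //.
have fs0 : frac_const s != 0.
  by apply: contraNneq s0 => /frac_const_inj->.
have fsu : frac_const s \is a GRing.unit by [].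
apply: (mulrI fsu); rewrite mulrA divrr // mul1r.
apply: (act_ext (oner_neq0 T) _ (act_const a 1)); rewrite mul1r.
by apply: act_mul (act_const s 1) _; rewrite mul1r.
Qed.

End OreLocalization.

Lemma left_fractions_exist (T : nzRingType) : left_Ore_domain T ->
  exists (Q : unitRingType) (f : {rmorphism T -> Q}), left_fractions f.
Proof.
move=> T_Ore; exists (frac T_Ore), (frac_const T_Ore).
exact: frac_const_left_fractions.
Qed.

(** * Uniqueness of the left ring of fractions *)

Section LeftFractions.
Variables (T : nzRingType) (T_Ore : left_Ore_domain T).

Lemma left_fractions_unit (Q : unitRingType) (f : {rmorphism T -> Q}) :
  left_fractions f -> forall s, s != 0 -> f s \is a GRing.unit.
Proof.
by case=> [Qdiv [finj _]] s s0; apply: Qdiv; rewrite -(rmorph0 f) (inj_eq finj).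
Qed.

(** Both [q] and [q'] are [s^-1 a], read in two rings. The symmetry of the relation yields two
    mutually inverse morphisms. *)
Definition same_fraction (Q Q' : unitRingType) (f : {rmorphism T -> Q})
    (f' : {rmorphism T -> Q'}) (q : Q) (q' : Q') : Prop :=
  exists s a, [/\ s != 0, f s * q = f a & f' s * q' = f' a].

Lemma same_fraction_uniq (Q Q' : unitRingType) (f : {rmorphism T -> Q})
    (f' : {rmorphism T -> Q'}) q q1 q2 :
  left_fractions f -> left_fractions f' ->
  same_fraction f f' q q1 -> same_fraction f f' q q2 -> q1 = q2.
Proof.
move=> fQ fQ' [s [a [s0 sq sq1]]] [s' [a' [s'0 s'q s'q2]]].
have [u [v [u0 us]]] := Ore_mult T_Ore s s'0.
have ua : u * a = v * a'.
  by apply: (proj1 (proj2 fQ)); rewrite !rmorphM -sq -s'q !mulrA -!rmorphM us.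
apply: (mulrI (left_fractions_unit fQ' (domain_mulf_neq0 T_Ore u0 s0))).
by rewrite {2}us !rmorphM -!mulrA sq1 s'q2 -!rmorphM ua.
Qed.

Lemma same_fraction_morphism (Q Q' : unitRingType) (f : {rmorphism T -> Q})
    (f' : {rmorphism T -> Q'}) :
  left_fractions f -> left_fractions f' ->
  exists g : {rmorphism Q -> Q'}, forall q, same_fraction f f' q (g q).
Proof.
move=> fQ fQ'; apply: graph_morphism.
- by exists 1, 1; rewrite !mulr1 oner_neq0.
- move=> q1 q1' q2 q2' [s1 [a1 [s10 e1 e1']]] [s2 [a2 [s20 e2 e2']]].
  have [u [v [u0 us]]] := Ore_mult T_Ore s1 s20.
  exists (u * s1), (u * a1 - v * a2); rewrite (domain_mulf_neq0 T_Ore) //.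
  split=> //; rewrite mulrBr {2}us !rmorphB !rmorphM -!mulrA.
    by rewrite e1 e2.
  by rewrite e1' e2'.
- move=> q1 q1' q2 q2' [s1 [a1 [s10 e1 e1']]] [s2 [a2 [s20 e2 e2']]].
  have [u [v [u0 ua]]] := Ore_mult T_Ore a1 s20.
  exists (u * s1), (v * a2); rewrite (domain_mulf_neq0 T_Ore) //.
  split=> //.
    by rewrite rmorphM mulrA -(mulrA (f u)) e1 -rmorphM ua !rmorphM -mulrA e2.
  by rewrite rmorphM mulrA -(mulrA (f' u)) e1' -rmorphM ua !rmorphM -mulrA e2'.
- move=> q; have [s [a [s0 ->]]] := proj2 (proj2 fQ) q.
  exists ((f' s)^-1 * f' a), s, a; rewrite s0 !mulrA !divrr ?mul1r //;
    exact: left_fractions_unit s0.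
- move=> q' [s [a [s0]]]; rewrite mulr0 -[LHS](rmorph0 f).
  move=> /(proj1 (proj2 fQ)) <- /esym; rewrite rmorph0 => /esym sq'.
  by apply: (mulrI (left_fractions_unit fQ' s0)); rewrite mulr0.
Qed.

Lemma left_fractions_uniq (Q Q' : unitRingType) (f : {rmorphism T -> Q})
    (f' : {rmorphism T -> Q'}) :
  left_fractions f -> left_fractions f' -> ring_iso Q Q'.
Proof.
move=> fQ fQ'.
have [g gP] := same_fraction_morphism fQ fQ'.
have [g' g'P] := same_fraction_morphism fQ' fQ.
have sym (P P' : unitRingType) (h : {rmorphism T -> P})
    (h' : {rmorphism T -> P'}) p p' :
    same_fraction h h' p p' -> same_fraction h' h p' p.
  by case=> s [a [? ? ?]]; exists s, a.
exists g, g' => q.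
  exact: (same_fraction_uniq fQ' fQ (g'P (g q)) (sym _ _ _ _ _ _ (gP q))).
exact: (same_fraction_uniq fQ fQ' (gP (g' q)) (sym _ _ _ _ _ _ (g'P q))).
Qed.

End LeftFractions.

(** * Transfer of the Ore property and of fractions along an embedding *)

Section LeftTransfer.
Variables (A B : nzRingType) (h : {rmorphism A -> B}).
Hypotheses (A_Ore : left_Ore_domain A) (h_inj : injective h).
Hypothesis hB : forall u, exists s a,
  [/\ s != 0, forall w, h s * w = 0 -> w = 0 & h s * u = h a].

(** [hB] asks that [h s] be cancellable, since [B] is not yet known to be a domain. If
    [h s * u = h a], [h s' * v = h a'] and [t * a = b * s'], then
    [h (t * s) * (u * v) = h (b * a')], so zero divisors in [B] lead back to [A]. *)
Lemma left_Ore_transfer : left_Ore_domain B.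
Proof.
have h_eq0 a : h a = 0 -> a = 0 by rewrite -(rmorph0 h) => /h_inj.
split=> [u v uv0 | u v v0].
  have [s [a [s0 s_reg su]]] := hB u; have [s' [a' [s'0 s'_reg s'v]]] := hB v.
  have [t [b [t0 ta]]] := Ore_mult A_Ore a s'0.
  have /h_eq0 : h (b * a') = 0.
    by rewrite rmorphM -s'v mulrA -rmorphM -ta rmorphM -mulrA -su -mulrA uv0 !mulr0.
  case/(proj1 A_Ore) => [b0 | a'0]; [left | right].
    apply: s_reg; rewrite su; move/eqP: ta; rewrite b0 mul0r => /eqP.
    case/(proj1 A_Ore) => [t_0|->]; last by rewrite rmorph0.
    by rewrite t_0 eqxx in t0.
  by apply: s'_reg; rewrite s'v a'0 rmorph0.
have [s [a [s0 s_reg su]]] := hB u; have [s' [a' [s'0 s'_reg s'v]]] := hB v.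
have a'0 : a' != 0.
  by apply: contraNneq v0 => a'0; apply/eqP/s'_reg; rewrite s'v a'0 rmorph0.
have [t [b [t0 ta]]] := Ore_mult A_Ore a a'0.
exists (h (b * s')), (h (t * s)); split.
  apply/eqP => /h_eq0/eqP; apply/negP; exact: (domain_mulf_neq0 A_Ore).
by rewrite !rmorphM -!mulrA su s'v -!rmorphM ta.
Qed.

(** In [(f u)^-1 * f v], the elements [u] and [v] have numerators [a'] and [a] over [s'] and [s];
    matching denominators by [t * s' = b * s] leaves [(t * a')^-1 (b * a)]. *)
Lemma left_fractions_comp (Q : unitRingType) (f : {rmorphism B -> Q}) :
  left_fractions f -> left_fractions (f \o h : {rmorphism A -> Q}).
Proof.
move=> fQ; have [Qdiv [finj fracQ]] := fQ; split=> //; split=> [|q].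
  exact: inj_comp.
have [u [v [u0 ->]]] := fracQ q.
have [s [a [s0 s_reg sv]]] := hB v; have [s' [a' [s'0 s'_reg s'u]]] := hB u.
have a'0 : a' != 0.
  by apply: contraNneq u0 => a'0; apply/eqP/s'_reg; rewrite s'u a'0 rmorph0.
have [t [b [t0 ts]]] := Ore_mult A_Ore s' s0.
have fU w : w != 0 -> f w \is a GRing.unit by apply: left_fractions_unit.
have hU w : w != 0 -> f (h w) \is a GRing.unit.
  by move=> w0; apply: fU; rewrite -(rmorph0 h) (inj_eq h_inj).
have ta0 := domain_mulf_neq0 A_Ore t0 a'0.
exists (t * a'), (b * a); split=> //=.
apply: (mulrI (hU _ ta0)); rewrite !mulrA divrr ?hU // mul1r.
rewrite !rmorphM -s'u !rmorphM !mulrA mulrK ?fU //.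
by rewrite -!rmorphM ts (rmorphM h b s) -mulrA sv -rmorphM.
Qed.

Lemma left_fractions_transfer :
  (exists (Q' : unitRingType) (f' : {rmorphism B -> Q'}), left_fractions f') /\
  (forall (Q Q' : unitRingType) (f : {rmorphism A -> Q})
      (f' : {rmorphism B -> Q'}),
    left_fractions f -> left_fractions f' -> ring_iso Q Q').
Proof.
split; first exact/left_fractions_exist/left_Ore_transfer.
move=> Q Q' f f' fQ fQ'.
exact: (left_fractions_uniq A_Ore fQ (left_fractions_comp fQ')).
Qed.

End LeftTransfer.

Lemma right_fractions_exist (T : nzRingType) : right_Ore_domain T ->
  exists (Q : unitRingType) (f : {rmorphism T -> Q}), right_fractions f.
Proof.
move=> /right_Ore_domainP /left_fractions_exist [Q [f [Qdiv [finj fracQ]]]].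
(* [f] starts from [T^c]; rereading its target as [Q^c] reverses products on both sides, so it is a
   morphism on [T] itself. *)
pose g : T -> Q^c := f.
have gB : zmod_morphism g by move=> a b; apply: (rmorphB f).
have gM : monoid_morphism g.
  by split=> [|a b]; [apply: (rmorph1 f) | apply: (rmorphM f b a)].
pose M1 := GRing.isZmodMorphism.Build T Q^c g gB.
pose M2 := GRing.isMonoidMorphism.Build T Q^c g gM.
pose G : {rmorphism T -> Q^c} := HB.pack g M1 M2.
by exists Q^c, G.
Qed.

Lemma right_fractions_transfer (A B : nzRingType) (h : {rmorphism A -> B}) :
  right_Ore_domain A -> injective h ->
  (forall u, exists s a,
    [/\ s != 0, forall w, w * h s = 0 -> w = 0 & u * h s = h a]) ->
  (exists (Q' : unitRingType) (f' : {rmorphism B -> Q'}), right_fractions f') /\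
  (forall (Q Q' : unitRingType) (f : {rmorphism A -> Q})
      (f' : {rmorphism B -> Q'}),
    right_fractions f -> right_fractions f' -> ring_iso Q Q').
Proof.
move=> /right_Ore_domainP A_Ore h_inj hB.
have B_Ore := @left_Ore_transfer _ _ (conv_morph h) A_Ore h_inj hB.
split; first exact/right_fractions_exist/right_Ore_domainP.
move=> Q Q' f f' /right_fractionsP fQ /right_fractionsP fQ'.
apply: ring_iso_conv.
have [_] := @left_fractions_transfer _ _ (conv_morph h) A_Ore h_inj hB.
by apply; eassumption.
Qed.

(** * Linear dependence over left Ore domains *)

(** Gaussian elimination without division, by induction on the number of columns: with
    [t * a = b * pivot], the row of [a] times [t] minus the pivot row times [b] has first entry
    zero. *)
Lemma left_dependence (R : nzRingType) (R_Ore : left_Ore_domain R) (p q : nat)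
    (A : 'M[R]_(p, q)) : (q < p)%N -> exists2 u : 'rV_p, u != 0 & u *m A = 0.
Proof.
elim: q p A => [|q IHq] [//|p] A lt_qp.
  exists (const_mx 1); last by apply/matrixP=> i [].
  by apply/rV0Pn; exists 0; rewrite mxE oner_neq0.
have [/forallP A0 | /forallPn[i0 Ai0]] := boolP [forall i, A i 0 == 0].
  have [u u0 uA] := IHq _ (col' 0 A) (ltnW lt_qp); exists u => //.
  apply/matrixP=> i j; rewrite !mxE.
  case: (unliftP 0 j) => [k ->|->].
    move/matrixP: uA => /(_ i k); rewrite !mxE => uA; rewrite -[RHS]uA.
    by apply: eq_bigr => l _; rewrite !mxE.
  by rewrite big1 // => l _; rewrite (eqP (A0 l)) mulr0.
have elim_row k : exists tb : R * R,
    tb.1 != 0 /\ tb.1 * A (lift i0 k) 0 = tb.2 * A i0 0.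
  by have [t [b H]] := Ore_mult R_Ore (A (lift i0 k) 0) Ai0; exists (t, b).
pose tb k := proj1_sig (constructive_indefinite_description _ (elim_row k)).
have tbP k : (tb k).1 != 0 /\ (tb k).1 * A (lift i0 k) 0 = (tb k).2 * A i0 0.
  by rewrite /tb; case: constructive_indefinite_description.
pose W := \matrix_(k < p, j < q)
  ((tb k).1 * A (lift i0 k) (lift 0 j) - (tb k).2 * A i0 (lift 0 j)).
have [w w0 wW] := IHq _ W lt_qp.
(* The relation [w] among the reduced rows, rewritten in the original rows; all multiples of the
   pivot row gather at [i0]. *)
pose u := \row_i (if unlift i0 i is Some k then w 0 k * (tb k).1
                  else - \sum_k w 0 k * (tb k).2).
have uA j : (u *m A) 0 j =
    \sum_k w 0 k * ((tb k).1 * A (lift i0 k) j - (tb k).2 * A i0 j).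
  rewrite mxE (bigD1_ord i0) //= mxE unlift_none mulNr mulr_suml -sumrN -big_split /=.
  by apply: eq_bigr => k _; rewrite mxE liftK mulrBr !mulrA addrC.
exists u.
  have /rV0Pn[k wk] := w0; apply/rV0Pn; exists (lift i0 k).
  by rewrite mxE liftK (domain_mulf_neq0 R_Ore) //; case: (tbP k).
apply/rowP=> j; rewrite uA mxE; case: (unliftP 0 j) => [l ->|->].
  move/rowP: wW => /(_ l); rewrite !mxE => wW; rewrite -[RHS]wW.
  by apply: eq_bigr => k _; rewrite mxE.
by rewrite big1 // => k _; case: (tbP k) => _ ->; rewrite subrr mulr0.
Qed.

Lemma left_dependence_fin (R : nzRingType) (R_Ore : left_Ore_domain R)
    (I J : finType) (V : I -> J -> R) : (#|J| < #|I|)%N ->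
  exists u : I -> R, (exists i, u i != 0) /\
    forall j, \sum_i u i * V i j = 0.
Proof.
move=> lt_JI; pose A := \matrix_(i < #|I|, j < #|J|) V (enum_val i) (enum_val j).
have [w /rV0Pn[k wk] wA] := left_dependence R_Ore A lt_JI.
exists (fun i => w 0 (enum_rank i)); split.
  by exists (enum_val k); rewrite enum_valK.
move=> j; move/rowP: wA => /(_ (enum_rank j)); rewrite !mxE => wA; rewrite -[RHS]wA.
rewrite (reindex _ (onW_bij _ (@enum_val_bij I))) /=.
by apply: eq_bigr => i _; rewrite mxE enum_valK enum_rankK.
Qed.

(** Bernoulli's inequality [(m / (m + d))^k >= 1 - k d / (m + d)] with denominators cleared. *)
Lemma expn_addl_leq (m d k : nat) :
  ((m + d) ^ k * (m + d) <= m ^ k * (m + d) + k * d * (m + d) ^ k)%N.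
Proof.
elim: k => [|k IHk]; first by rewrite !mul0n addn0.
rewrite expnSr (leq_trans (leq_mul IHk (leqnn _))) //.
rewrite mulnDl -mulnA [(m ^ k.+1)%N]expnSr mulSn.
have -> : (m ^ k * ((m + d) * (m + d)) =
   m ^ k * m * (m + d) + d * (m ^ k * (m + d)))%N.
  by rewrite mulnDl mulnDr !mulnA; congr (_ + _)%N; rewrite mulnAC mulnC mulnA.
rewrite -addnA leq_add2l mulnDl !mulnA leq_add2r -!mulnA leq_mul2l.
case: k {IHk} => [|k]; first by rewrite leqnn orbT.
by rewrite leq_mul2r leq_exp2r // leq_addr !orbT.
Qed.

Lemma box_growth (n d : nat) : exists m, ((m + d) ^ n < 2 * m ^ n)%N.
Proof.
(* Then [2 n d < m + d], so the error term [n d (m + d)^n] is less than half of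
   [(m + d)^(n + 1)]. *)
pose m := (2 * n * d).+1; exists m.
have md0 : (0 < m + d)%N by [].
rewrite -(ltn_pmul2r md0) -(ltn_add2l ((m + d) ^ n * (m + d))).
rewrite addnn -mul2n.
apply: (@leq_ltn_trans (2 * (m ^ n * (m + d) + n * d * (m + d) ^ n))).
  by rewrite leq_mul2l expn_addl_leq.
rewrite mulnDr addnC !mulnA ltn_add2r mulnC ltn_mul2l expn_gt0 md0 /=.
by rewrite ltn_addr.
Qed.

(** Uniqueness of base [N] expansions: the digit at [ord0] is the remainder modulo [N], and the
    quotient carries the others. *)
Lemma digits_inj (n N : nat) (a b : 'I_n -> nat) :
  (forall i, (a i < N)%N) -> (forall i, (b i < N)%N) ->
  (\sum_(i < n) a i * N ^ i = \sum_(i < n) b i * N ^ i)%N -> a =1 b.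
Proof.
elim: n a b => [|n IHn] a b a_lt b_lt; first by move=> _ [].
have step (c : 'I_n.+1 -> nat) : (\sum_(i < n.+1) c i * N ^ i =
    (\sum_(i < n) c (lift ord0 i) * N ^ i) * N + c ord0)%N.
  rewrite big_ord_recl muln1 addnC big_distrl; congr (_ + _)%N.
  by apply: eq_bigr => i _ /=; rewrite -mulnA -expnSr.
rewrite !step => eq_ab.
have N0 : (0 < N)%N := leq_ltn_trans (leq0n _) (a_lt ord0).
have eq0 : a ord0 = b ord0.
  by have := congr1 (modn^~ N) eq_ab; rewrite !modnMDl !modn_small.
have eqS : (fun i => a (lift ord0 i)) =1 (fun i => b (lift ord0 i)).
  apply: IHn => // ; move/eqP: eq_ab.
  by rewrite eq0 eqn_add2r eqn_pmul2r // => /eqP.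
by move=> i; case: (unliftP ord0 i) => [j ->|->]; [apply: eqS|].
Qed.

(** * Rings with a monomial basis *)

Lemma sum_pred1_seq (V : nmodType) (I : eqType) (r : seq I) (i : I) (F : I -> V) :
  uniq r -> i \in r -> \sum_(j <- r | j == i) F j = F i.
Proof.
move=> r_uniq ri; rewrite big_mkcond (bigD1_seq i) //= eqxx.
by rewrite big1 ?addr0 // => j /negPf->.
Qed.

Definition madd (n : nat) (a b : mexp n) : mexp n := [ffun i => (a i + b i)%N].

Lemma maddC n (a b : mexp n) : madd a b = madd b a.
Proof. by apply/ffunP => i; rewrite !ffunE addnC. Qed.

Lemma madd_inj n (a : mexp n) : injective (madd a).
Proof.
by move=> b c /ffunP bc; apply/ffunP => i; have := bc i; rewrite !ffunE => /addnI.
Qed.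

(** Freeness speaks of duplicate-free lists, while expanded products repeat exponents; like terms
    are collected here. *)
Lemma sum_by_exponent (R A : nzRingType) (f : {rmorphism R -> A}) n
    (X : mexp n -> A) (I : Type) (r : seq I) (c : I -> R) (h : I -> mexp n)
    (S : seq (mexp n)) : uniq S -> {subset map h r <= S} ->
  \sum_(i <- r) f (c i) * X (h i) =
    \sum_(e <- S) f (\sum_(i <- r | h i == e) c i) * X e.
Proof.
move=> S_uniq rS.
transitivity (\sum_(i <- r) \sum_(e <- S | h i == e) f (c i) * X e).
  elim: r rS => [|i r IHr] rS; first by rewrite !big_nil.
  rewrite !big_cons IHr; last by move=> e er; apply: rS; rewrite inE er orbT.
  congr (_ + _); under eq_bigl => e do rewrite eq_sym.
  by rewrite sum_pred1_seq // rS ?mem_head.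
rewrite (exchange_big_dep xpredT) //=; apply: eq_bigr => e _.
by rewrite rmorph_sum mulr_suml.
Qed.

Section Freeness.
Variables (R A : nzRingType) (f : {rmorphism R -> A}) (n : nat) (X : mexp n -> A).

Definition left_free : Prop := forall (s : seq (mexp n)) (c : mexp n -> R),
  uniq s -> \sum_(a <- s) f (c a) * X a = 0 -> forall a, a \in s -> c a = 0.

Hypothesis X_free : left_free.

(** Both sums are collected over a joint support [S], where freeness applies to the difference;
    outside [S] both coefficients are empty sums. *)
Lemma left_free_coef (I J : Type) (r : seq I) (s : seq J) (c : I -> R)
    (d : J -> R) (h : I -> mexp n) (k : J -> mexp n) :
  \sum_(i <- r) f (c i) * X (h i) = \sum_(j <- s) f (d j) * X (k j) ->
  forall e, \sum_(i <- r | h i == e) c i = \sum_(j <- s | k j == e) d j.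
Proof.
pose S := undup (map h r ++ map k s).
have S_uniq : uniq S by apply: undup_uniq.
have rS : {subset map h r <= S}.
  by move=> e er; rewrite mem_undup mem_cat er.
have sS : {subset map k s <= S}.
  by move=> e es; rewrite mem_undup mem_cat es orbT.
rewrite (sum_by_exponent _ _ _ S_uniq rS) [RHS](sum_by_exponent _ _ _ S_uniq sS).
move=> /eqP; rewrite -subr_eq0 -sumrB => /eqP sum0 e.
have [eS|eS] := boolP (e \in S).
  apply/eqP; rewrite -subr_eq0; apply/eqP.
  pose z e' := \sum_(i <- r | h i == e') c i - \sum_(j <- s | k j == e') d j.
  apply: (@X_free S z S_uniq _ e eS).
  by rewrite -[RHS]sum0; apply: eq_bigr => e' _; rewrite rmorphB mulrBl.
have notS (L : Type) (l : seq L) (g : L -> mexp n) :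
    {subset map g l <= S} -> ~~ has (fun i => g i == e) l.
  move=> lS; apply: contra eS => gl; apply: lS.
  by rewrite -has_pred1 has_map; apply: sub_has gl => i.
by rewrite !big_hasC ?notS.
Qed.

Lemma left_free_coef0 (I : Type) (r : seq I) (c : I -> R) (h : I -> mexp n) :
  \sum_(i <- r) f (c i) * X (h i) = 0 ->
  forall e, \sum_(i <- r | h i == e) c i = 0.
Proof.
move=> sum0 e.
by rewrite (@left_free_coef _ I r [::] c (fun=> 0) h h) ?big_nil.
Qed.

Lemma left_free_inj r r' e : f r * X e = f r' * X e -> r = r'.
Proof.
move=> eq_rr'.
have := @left_free_coef unit unit [:: tt] [:: tt]
  (fun=> r) (fun=> r') (fun=> e) (fun=> e).
by rewrite !big_seq1 => /(_ eq_rr' e); rewrite !big_cons !big_nil eqxx !addr0.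
Qed.

End Freeness.

(* The part of the structure of a PBW extension that is stable under passing
   to converse rings: the order of the variables in the monomials [X a] no
   longer matters. *)
Record skew_monomials (R A : nzRingType) (f : {rmorphism R -> A}) (n : nat)
    (X : mexp n -> A) : Prop := SkewMonomials {
  skm_span : forall t, exists (s : seq (mexp n)) (c : mexp n -> R),
    t = \sum_(a <- s) f (c a) * X a;
  skm_free : left_free f X;
  skm_twist : forall a r, exists r', X a * f r = f r' * X a /\ (r != 0 -> r' != 0);
  skm_mul : forall a b, exists d, d != 0 /\ X a * X b = f d * X (madd a b) }.

Section SkewMonomials.
Variables (R A : nzRingType) (f : {rmorphism R -> A}) (n : nat) (X : mexp n -> A).
Hypotheses (R_Ore : left_Ore_domain R) (XA : skew_monomials f X).

Definition box (M : nat) : finType := {ffun 'I_n -> 'I_M}.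
Definition of_box M (a : box M) : mexp n := [ffun i => a i : nat].

Lemma card_box M : #|box M| = (M ^ n)%N.
Proof. by rewrite card_ffun !card_ord. Qed.

Lemma of_box_inj M : injective (@of_box M).
Proof.
by move=> a b /ffunP ab; apply/ffunP => i; apply/val_inj; have := ab i; rewrite !ffunE.
Qed.

Lemma box_free M (c : box M -> R) :
  \sum_a f (c a) * X (of_box a) = 0 -> forall a, c a = 0.
Proof.
move=> /(left_free_coef0 (skm_free XA)) c0 a; rewrite -[RHS](c0 (of_box a)).
by rewrite (big_pred1 a) // => b; rewrite /= (inj_eq (@of_box_inj M)).
Qed.

Definition in_box M (t : A) : Prop :=
  exists c : box M -> R, t = \sum_a f (c a) * X (of_box a).

Lemma in_box0 M : in_box M 0.
Proof. by exists (fun=> 0); rewrite big1 // => a _; rewrite rmorph0 mul0r. Qed.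

Lemma in_boxD M t u : in_box M t -> in_box M u -> in_box M (t + u).
Proof.
move=> [c ->] [d ->]; exists (fun a => c a + d a).
by rewrite -big_split; apply: eq_bigr => a _; rewrite rmorphD mulrDl.
Qed.

Lemma in_box_monomial M r (e : mexp n) :
  (forall i, (e i < M)%N) -> in_box M (f r * X e).
Proof.
move=> e_lt; pose a : box M := [ffun i => Ordinal (e_lt i)].
have aE : of_box a = e by apply/ffunP => i; rewrite !ffunE.
exists (fun b => if b == a then r else 0).
rewrite (bigD1 a) //= eqxx aE big1 ?addr0 // => b /negPf->.
by rewrite rmorph0 mul0r.
Qed.

Lemma in_box_sum M (I : Type) (r : seq I) (P : pred I) (F : I -> A) :
  (forall i, P i -> in_box M (F i)) -> in_box M (\sum_(i <- r | P i) F i).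
Proof. by apply: big_ind; [apply: in_box0 | apply: in_boxD]. Qed.

Lemma in_box_leq M M' t : (M <= M')%N -> in_box M t -> in_box M' t.
Proof.
move=> leM [c ->]; apply: in_box_sum => a _; apply: in_box_monomial => i.
by rewrite ffunE (leq_trans (ltn_ord _)).
Qed.

Lemma in_box_ex t : exists M, in_box M t.
Proof.
have [s [c ->]] := skm_span XA t.
(* The successor is taken because a box bounds exponents strictly. *)
exists (\max_(a <- s) \max_i a i).+1.
rewrite [X in in_box _ X]big_seq; apply: in_box_sum => a sa.
apply: in_box_monomial => i.
rewrite ltnS; apply: (leq_trans (leq_bigmax i)).
exact: (leq_bigmax_seq (F := fun a : mexp n => (\max_i a i)%N) a sa isT).
Qed.

Lemma skm_mul_term r a r' b : exists s,
  (r != 0 -> r' != 0 -> s != 0) /\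
  (f r * X a) * (f r' * X b) = f s * X (madd a b).
Proof.
have [r'' [tw r''0]] := skm_twist XA a r'; have [d [d0 md]] := skm_mul XA a b.
exists (r * r'' * d); split.
  by move=> r0 /r''0 ?; rewrite !(domain_mulf_neq0 R_Ore).
by rewrite mulrA -(mulrA (f r)) tw !rmorphM -!mulrA md.
Qed.

Lemma in_box_mul M M' (e : mexp n) t : (forall i, (e i < M)%N) -> in_box M' t ->
  in_box (M + M') (X e * t).
Proof.
move=> e_lt [c ->]; rewrite mulr_sumr; apply: in_box_sum => b _.
have [s [_ sE]] := skm_mul_term 1 e (c b) (of_box b).
rewrite rmorph1 mul1r in sE; rewrite sE; apply: in_box_monomial => i.
by rewrite !ffunE -addnS leq_add // ltnW.
Qed.

(* Weighting the exponents by powers of a large [M] totally orders the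
   monomials of a box compatibly with products, so leading terms multiply. *)
Lemma skm_domain : domain A.
Proof.
move=> t u tu0; apply: NNPP => /not_or_and[t0 u0].
have [M1 tM] := in_box_ex t; have [M2 uM] := in_box_ex u.
pose M := maxn M1 M2.
have [c tE] : in_box M t by apply: in_box_leq (leq_maxl _ _) tM.
have [d uE] : in_box M u by apply: in_box_leq (leq_maxr _ _) uM.
have nz (z : box M -> R) v : v = \sum_a f (z a) * X (of_box a) -> v <> 0 ->
    exists a, z a != 0.
  move=> vE v0; apply: NNPP => z0; apply: v0; rewrite vE big1 // => a _.
  have [->|za] := eqVneq (z a) 0; first by rewrite rmorph0 mul0r.
  by case: z0; exists a.
have [a1 ca1] := nz _ _ tE t0; have [b1 db1] := nz _ _ uE u0.
(* Linear in the exponents, the weight adds up in products even where a sum of digits exceeds [M];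
   injectivity concerns the factors alone. *)
pose w (a : box M) := (\sum_(i < n) a i * M ^ i)%N.
have w_inj : injective w.
  by move=> a b wab; apply/ffunP => i; apply/val_inj;
     apply: (@digits_inj _ M (fun i => a i) (fun i => b i)).
case: (@arg_maxnP _ a1 (fun a => c a != 0) w ca1) => a ca a_max.
case: (@arg_maxnP _ b1 (fun b => d b != 0) w db1) => b db b_max.
have term_ex (p : box M * box M) : exists s : R,
    (c p.1 != 0 -> d p.2 != 0 -> s != 0) /\
    (f (c p.1) * X (of_box p.1)) * (f (d p.2) * X (of_box p.2)) =
      f s * X (madd (of_box p.1) (of_box p.2)) by apply: skm_mul_term.
pose g p := proj1_sig (constructive_indefinite_description _ (term_ex p)).
have gP p : (c p.1 != 0 -> d p.2 != 0 -> g p != 0) /\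
    (f (c p.1) * X (of_box p.1)) * (f (d p.2) * X (of_box p.2)) =
      f (g p) * X (madd (of_box p.1) (of_box p.2)).
  by rewrite /g; case: constructive_indefinite_description.
(* Thus the maximality of [a] and [b] bounds the weights in every pair that contributes to the
   product. *)
have g0 p : g p != 0 -> c p.1 != 0 /\ d p.2 != 0.
  have [_ gE] := gP p; move=> gp.
  have gX : (f (c p.1) * X (of_box p.1)) * (f (d p.2) * X (of_box p.2)) != 0.
    apply: contraNneq gp; rewrite gE => gX0; apply/eqP.
    apply: (left_free_inj (skm_free XA) (e := madd (of_box p.1) (of_box p.2))).
    by rewrite gX0 rmorph0 mul0r.
  by split; apply: contraNneq gX => ->; rewrite rmorph0 mul0r ?mulr0 ?mul0r.
have sum0 : \sum_p f (g p) * X (madd (of_box p.1) (of_box p.2)) = 0.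
  rewrite -[RHS]tu0 tE uE mulr_suml.
  under [RHS]eq_bigr => a' _ do rewrite mulr_sumr.
  by rewrite pair_bigA; apply: eq_bigr => p _; have [_ ->] := gP p.
have gab : g (a, b) != 0 by apply: (proj1 (gP (a, b))).
have := left_free_coef0 (skm_free XA) sum0 (madd (of_box a) (of_box b)).
rewrite (bigD1 (a, b)) //= big1 ?addr0 => [ab0|[a' b'] /= /andP[/eqP eq_ab ne_ab]].
  by rewrite ab0 eqxx in gab.
apply/eqP; apply: contraNT ne_ab => /g0[/= ca' db'].
(* Another pair with the same product exponent has the same total weight; as neither weight exceeds
   its maximum, both agree, and the pair is [(a, b)]. *)
have w_eq : (w a' + w b' = w a + w b)%N.
  rewrite -!big_split; apply: eq_bigr => i _ /=; rewrite -!mulnDl.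
  by have /ffunP/(_ i) := eq_ab; rewrite !ffunE => ->.
have le_a : (w a' <= w a)%N := a_max _ ca'.
have le_b : (w b' <= w b)%N := b_max _ db'.
have wa : w a' = w a.
  by apply/eqP; rewrite eqn_leq le_a -(leq_add2r (w b')) w_eq leq_add2l.
by move: w_eq; rewrite wa => /addnI wb; rewrite (w_inj _ _ wa) (w_inj _ _ wb).
Qed.

Lemma skm_left_Ore : left_Ore A.
Proof.
move=> a s s0.
have [M1 aM] := in_box_ex a; have [M2 sM] := in_box_ex s.
pose d := maxn M1 M2; have [m lt_m] := box_growth n d.
have {}aM : in_box d a by apply: in_box_leq (leq_maxl _ _) aM.
have {}sM : in_box d s by apply: in_box_leq (leq_maxr _ _) sM.
(* The two summands index the monomials multiplied by [a] and by [s]; [V] will hold the coordinates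
   of these products. *)
have V_ex (k : box m + box m) : exists c : box (m + d) -> R,
    match k with inl e => X (of_box e) * a | inr e => X (of_box e) * s end =
    \sum_e f (c e) * X (of_box e).
  by case: k => e; apply: in_box_mul => // i; rewrite ffunE.
pose V k := proj1_sig (constructive_indefinite_description _ (V_ex k)).
have VE k : match k with inl e => X (of_box e) * a | inr e => X (of_box e) * s end =
    \sum_e f (V k e) * X (of_box e).
  by rewrite /V; case: constructive_indefinite_description.
have [|u [[k uk] uV]] := left_dependence_fin R_Ore V.
  by rewrite card_sum !card_box addnn -mul2n.
pose t := \sum_e f (u (inl e)) * X (of_box e).
pose b := \sum_e f (u (inr e)) * X (of_box e).
have tb : t * a + b * s = 0.
  rewrite /t /b !mulr_suml.
  under eq_bigr => e _ do rewrite -mulrA (VE (inl e)) mulr_sumr.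
  under [X in _ + X]eq_bigr => e _ do rewrite -mulrA (VE (inr e)) mulr_sumr.
  rewrite exchange_big [X in _ + X]exchange_big /= -big_split big1 //= => e _.
  under eq_bigr => e' _ do rewrite mulrA -rmorphM.
  under [X in _ + X]eq_bigr => e' _ do rewrite mulrA -rmorphM.
  rewrite -!mulr_suml -mulrDl -!rmorph_sum -rmorphD.
  by rewrite -[X in f X](big_sumType _ xpredT (fun k => u k * V k e)) uV rmorph0 mul0r.
exists (- b), t; split; last by apply/eqP; rewrite mulNr -addr_eq0 tb.
(* If [t] vanished, so would [b * s] and hence [b]; by freeness all coefficients [u] would be
   zero. *)
apply: contraNneq uk => t0; move: tb; rewrite t0 mul0r add0r.
case/skm_domain => [b0|s_0]; last by rewrite s_0 eqxx in s0.
by case: k => e; [rewrite (box_free t0)|rewrite (box_free b0)].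
Qed.

Lemma skm_left_Ore_domain : left_Ore_domain A.
Proof. by split; [apply: skm_domain | apply: skm_left_Ore]. Qed.

End SkewMonomials.

(** * Monomials in quasi-commuting variables *)

Section QuasiCommutingWords.
Variables (R T : nzRingType) (f : {rmorphism R -> T}).
Hypothesis R_Ore : left_Ore_domain R.

Definition twisting (y : T) : Prop :=
  forall r, exists r', y * f r = f r' * y /\ (r != 0 -> r' != 0).

(** For [y = x i] this is surjectivity of [sigma_i] on [R]. *)
Definition untwisting (y : T) : Prop :=
  forall r, exists r', y * f r' = f r * y.

(** The relation is directed, as [d] need not be invertible; transitivity uses that [R] is a
    domain. *)
Definition equiv_upto (y z : T) : Prop := exists d, d != 0 /\ y = f d * z.

Lemma twisting1 : twisting 1.
Proof. by move=> r; exists r; rewrite mulr1 mul1r. Qed.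

Lemma twistingM y z : twisting y -> twisting z -> twisting (y * z).
Proof.
move=> yt zt r; have [r1 [e1 n1]] := zt r; have [r2 [e2 n2]] := yt r1.
by exists r2; rewrite -mulrA e1 mulrA e2 mulrA; split=> // /n1.
Qed.

Lemma twistingX y k : twisting y -> twisting (y ^+ k).
Proof.
move=> yt; elim: k => [|k IHk]; first exact: twisting1.
by rewrite exprS; apply: twistingM.
Qed.

Lemma untwisting1 : untwisting 1.
Proof. by move=> r; exists r; rewrite mulr1 mul1r. Qed.

Lemma untwistingM y z : untwisting y -> untwisting z -> untwisting (y * z).
Proof.
move=> yt zt r; have [r1 e1] := yt r; have [r2 e2] := zt r1.
by exists r2; rewrite -mulrA e2 mulrA e1 mulrA.
Qed.

Lemma untwistingX y k : untwisting y -> untwisting (y ^+ k).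
Proof.
move=> yt; elim: k => [|k IHk]; first exact: untwisting1.
by rewrite exprS; apply: untwistingM.
Qed.

Lemma equiv_upto_refl y : equiv_upto y y.
Proof. by exists 1; rewrite oner_neq0 rmorph1 mul1r. Qed.

Lemma equiv_upto_trans y z t : equiv_upto y z -> equiv_upto z t -> equiv_upto y t.
Proof.
move=> [d [d0 ->]] [e [e0 ->]]; exists (d * e).
by rewrite (domain_mulf_neq0 R_Ore) // rmorphM mulrA.
Qed.

Lemma equiv_uptoM y y' z z' : twisting y' ->
  equiv_upto y y' -> equiv_upto z z' -> equiv_upto (y * z) (y' * z').
Proof.
move=> y't [d [d0 ->]] [e [e0 ->]]; have [e' [tw e'0]] := y't e.
exists (d * e'); rewrite (domain_mulf_neq0 R_Ore) ?e'0 //; split=> //.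
by rewrite mulrA -(mulrA (f d)) tw rmorphM !mulrA.
Qed.

Definition qcomm (y z : T) : Prop := equiv_upto (y * z) (z * y).

Lemma qcommMr y z t : twisting y -> twisting z ->
  qcomm y z -> qcomm y t -> qcomm y (z * t).
Proof.
move=> yt zt yz yt'; apply: (@equiv_upto_trans _ (z * y * t)).
  by rewrite mulrA; apply: equiv_uptoM (equiv_upto_refl t); [apply: twistingM|].
by rewrite -!mulrA; apply: equiv_uptoM (equiv_upto_refl z) yt'.
Qed.

Lemma qcommMl y z t : twisting y -> twisting z -> twisting t ->
  qcomm y t -> qcomm z t -> qcomm (y * z) t.
Proof.
move=> yt zt tt yt' zt'; apply: (@equiv_upto_trans _ (y * t * z)).
  by rewrite -!mulrA; apply: equiv_uptoM (equiv_upto_refl y) zt'.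
by rewrite [t * _]mulrA; apply: equiv_uptoM (equiv_upto_refl z); [apply: twistingM|].
Qed.

Lemma qcomm1r y : qcomm y 1.
Proof. by rewrite /qcomm mulr1 mul1r; apply: equiv_upto_refl. Qed.

Lemma qcomm1l y : qcomm 1 y.
Proof. by rewrite /qcomm mulr1 mul1r; apply: equiv_upto_refl. Qed.

Lemma qcommXr y z k : twisting y -> twisting z -> qcomm y z -> qcomm y (z ^+ k).
Proof.
move=> yt zt yz; elim: k => [|k IHk]; first exact: qcomm1r.
by rewrite exprS; apply: qcommMr.
Qed.

Lemma qcommXl y z k : twisting y -> twisting z -> qcomm y z -> qcomm (y ^+ k) z.
Proof.
move=> yt zt yz; elim: k => [|k IHk]; first exact: qcomm1l.
by rewrite exprS; apply: qcommMl => //; apply: twistingX.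
Qed.

Section Monomials.
Variables (n : nat) (x : 'I_n -> T).
Hypotheses (x_twist : forall i, twisting (x i))
  (x_comm : forall i j, qcomm (x i) (x j)).

Lemma twisting_monomial a : twisting (monomial x a).
Proof.
rewrite /monomial; apply: big_ind => [||i _]; first exact: twisting1.
  exact: twistingM.
exact: twistingX.
Qed.

Lemma untwisting_monomial a :
  (forall i, untwisting (x i)) -> untwisting (monomial x a).
Proof.
move=> xu; rewrite /monomial; apply: big_ind => [||i _]; first exact: untwisting1.
  exact: untwistingM.
exact: untwistingX.
Qed.

Lemma monomial_mul a b :
  equiv_upto (monomial x a * monomial x b) (monomial x (madd a b)).
Proof.
rewrite /monomial; elim: (index_enum _) => [|i r IHr].
  by rewrite !big_nil mulr1; apply: equiv_upto_refl.
have words_twist (c : mexp n) s : twisting (\prod_(j <- s) x j ^+ c j).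
  by apply: big_ind => [||j _]; [exact: twisting1|exact: twistingM|exact: twistingX].
rewrite !big_cons ffunE exprD.
set P := (\prod_(j <- r) x j ^+ a j) in IHr *.
set Q := (\prod_(j <- r) x j ^+ b j) in IHr *.
set u := x i ^+ a i; set v := x i ^+ b i.
(* Moving the power [v] of [x i] left across the remaining word [P] is the one reordering of the
   inductive step. *)
have Pv : qcomm P v.
  apply: qcommXr; [exact: words_twist | exact: x_twist |].
  rewrite /P; elim: (r) => [|j s IHs]; first by rewrite big_nil; apply: qcomm1l.
  by rewrite big_cons; apply: qcommMl => //; [apply: twistingX|apply: qcommXl].
have ut : twisting u by apply: twistingX.
have vt : twisting v by apply: twistingX.
apply: (@equiv_upto_trans _ (u * (v * P) * Q)).
  rewrite mulrA -(mulrA u); apply: equiv_uptoM (equiv_upto_refl Q).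
    by apply: twistingM => //; apply: twistingM => //; apply: words_twist.
  exact: equiv_uptoM (equiv_upto_refl u) Pv.
rewrite mulrA -mulrA; apply: equiv_uptoM (equiv_upto_refl _) IHr.
exact: twistingM.
Qed.

End Monomials.
End QuasiCommutingWords.

Definition mdelta (n : nat) (i : 'I_n) : mexp n := [ffun j => (j == i) : nat].

Lemma monomial_delta (T : nzRingType) n (x : 'I_n -> T) i :
  monomial x (mdelta i) = x i.
Proof.
rewrite /monomial (eq_bigr (fun j => if j == i then x j else 1)).
  by rewrite -big_mkcond big_pred1_eq.
by move=> j _; rewrite ffunE; case: eqP; rewrite ?expr1 ?expr0.
Qed.

Lemma monomial0 (T : nzRingType) n (x : 'I_n -> T) :
  monomial x [ffun=> 0%N] = 1.
Proof. by rewrite /monomial big1 // => i _; rewrite ffunE expr0. Qed.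

(** * Quasi-commutative PBW extensions as rings with skew monomials *)

Section PBW.
Variables (R A : nzRingType) (iota : {rmorphism R -> A}) (n : nat) (x : 'I_n -> A).
Hypotheses (R_Ore : left_Ore_domain R) (PBW : qc_skew_PBW iota x).

Lemma PBW_twisting i : twisting iota (x i).
Proof.
move=> r; have [->|r0] := eqVneq r 0.
  by exists 0; rewrite rmorph0 mulr0 mul0r eqxx.
by case: PBW => _ _ tw _; have [c [c0 e]] := tw i r r0; exists c.
Qed.

Lemma PBW_qcomm i j : qcomm iota (x i) (x j).
Proof. by case: PBW => _ _ _ /(_ j i) [c [c0 e]]; exists c; rewrite mulrA. Qed.

Lemma PBW_skew_monomials : skew_monomials iota (monomial x).
Proof.
case: PBW => iota_inj [xspan xfree] _ _; split=> //.
  exact: (twisting_monomial PBW_twisting).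
exact: (monomial_mul R_Ore PBW_twisting PBW_qcomm).
Qed.

(* Comparing coefficients in [x_i b = r x_i], only the constant term of [b]
   survives; so bijectivity of [sigma_i] on [B_{i-1}] gives bijectivity on [R]. *)
Lemma PBW_untwisting i : sigma_bijective iota x i -> untwisting iota (x i).
Proof.
move=> bij r.
have [|b [_ xb]] := bij (iota r).
  exists [:: [ffun=> 0%N]], (fun=> r); split.
    by move=> a; rewrite inE => /eqP-> j _; rewrite ffunE.
  by rewrite /lcomb big_seq1 monomial0 mulr1.
have XA := PBW_skew_monomials.
have [M [c bE]] := in_box_ex XA b.
have term_ex a : exists s, (c a != 0 -> s != 0) /\
    x i * (iota (c a) * monomial x (of_box a)) =
      iota s * monomial x (madd (mdelta i) (of_box a)).
  have [s [s0 sE]] := skm_mul_term R_Ore XA 1 (mdelta i) (c a) (of_box a).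
  exists s; split=> [|]; first by apply: s0; rewrite oner_neq0.
  by rewrite -sE rmorph1 mul1r monomial_delta.
pose s a := proj1_sig (constructive_indefinite_description _ (term_ex a)).
have sP a : (c a != 0 -> s a != 0) /\
    x i * (iota (c a) * monomial x (of_box a)) =
      iota (s a) * monomial x (madd (mdelta i) (of_box a)).
  by rewrite /s; case: constructive_indefinite_description.
have xbE : \sum_a iota (s a) * monomial x (madd (mdelta i) (of_box a)) =
    \sum_(j <- [:: tt]) iota r * monomial x (mdelta i).
  rewrite big_seq1 monomial_delta -xb bE mulr_sumr.
  by apply: eq_bigr => a _; case: (sP a).
(* Multiplication by [x i] shifts exponents injectively by [mdelta i], and the right-hand side of
   [xbE] has the exponent [mdelta i] only. *)
have c0 a : of_box a != [ffun=> 0%N] -> c a = 0.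
  move=> a0; apply: contraTeq a0 => /(proj1 (sP a)) sa; rewrite negbK.
  apply: contraNT sa => a0.
  have := left_free_coef (skm_free XA) xbE (madd (mdelta i) (of_box a)).
  rewrite (big_pred1 a) => [->|b']; last first.
    by rewrite /= (inj_eq (@madd_inj _ _)) (inj_eq (@of_box_inj _ _)).
  rewrite big_cons big_nil ifN //.
  apply: contraNneq a0 => eq_i; apply/eqP/(@madd_inj _ (mdelta i)).
  by rewrite -eq_i; apply/ffunP => j; rewrite !ffunE addn0.
(* The constant term of [b]: a sum of at most one summand, equal to [0] if the box is empty. *)
exists (\sum_(a | of_box a == [ffun=> 0%N]) c a).
rewrite -xb bE; congr (x i * _); rewrite rmorph_sum big_mkcond.
apply: eq_bigr => a _; case: eqP => [->|/eqP/c0->].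
  by rewrite monomial0 mulr1.
by rewrite rmorph0 mul0r.
Qed.

End PBW.

(** Scalars of the converse ring stand on the right, where [tau] moves them. For freeness they are
    brought back to the left by [skm_twist], which keeps nonzero scalars nonzero. *)
Lemma skew_monomials_conv (R A : nzRingType) (f : {rmorphism R -> A}) n
    (X : mexp n -> A) :
  left_Ore_domain R -> skew_monomials f X -> (forall a, untwisting f (X a)) ->
  @skew_monomials R^c A^c (conv_morph f) n X.
Proof.
move=> R_Ore XA Xu.
pose tau a r := proj1_sig (constructive_indefinite_description _ (Xu a r)).
have tauP a r : X a * f (tau a r) = f r * X a.
  by rewrite /tau; case: constructive_indefinite_description.
have tau0 a r : r != 0 -> tau a r != 0.
  apply: contraNneq => r0; apply/eqP/(left_free_inj (skm_free XA) (e := a)).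
  by rewrite -tauP r0 !rmorph0 mulr0 mul0r.
split.
- move=> t; have [s [c ->]] := skm_span XA t.
  exists s, (fun a => tau a (c a)); apply: eq_bigr => a _.
  exact/esym/tauP.
- move=> s c s_uniq sum0 a sa.
  have sg_ex b : exists r, (c b != 0 -> r != 0) /\ X b * f (c b) = f r * X b.
    by have [r [? ?]] := skm_twist XA b (c b); exists r.
  pose sg b := proj1_sig (constructive_indefinite_description _ (sg_ex b)).
  have sgP b : (c b != 0 -> sg b != 0) /\ X b * f (c b) = f (sg b) * X b.
    by rewrite /sg; case: constructive_indefinite_description.
  have sg0 : \sum_(b <- s) f (sg b) * X b = 0.
    by rewrite -[RHS]sum0; apply: eq_bigr => b _; case: (sgP b).
  have := skm_free XA s_uniq sg0 sa; have [sgn _] := sgP a.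
  by move=> /eqP; apply: contraTeq.
- by move=> a r; exists (tau a r); split; [apply/esym/tauP | apply: tau0].
(* The converse product of [X a] and [X b] is [X b * X a], hence the swapped arguments. *)
- move=> a b; have [d [d0 md]] := skm_mul XA b a.
  exists (tau (madd b a) d); split; first exact: tau0.
  by rewrite [LHS]md -tauP maddC.
Qed.

(** * The comparison map *)

Section Comparison.
Variables (R A K B : nzRingType) (iota : {rmorphism R -> A})
  (phi : {rmorphism R -> K}) (psi : {rmorphism K -> B})
  (n : nat) (x : 'I_n -> A) (y : 'I_n -> B).
Hypotheses (R_Ore : left_Ore_domain R) (PBW : qc_skew_PBW iota x).
Hypotheses (phi_inj : injective phi) (y_basis : left_monomial_basis psi y).
Hypothesis y_twist : forall i r r',
  x i * iota r = iota r' * x i -> y i * psi (phi r) = psi (phi r') * y i.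
Hypothesis y_comm : forall i j c,
  x j * x i = iota c * x i * x j -> y j * y i = psi (phi c) * y i * y j.

(** With [R] embedded diagonally, the pairs [(x i, y i)] quasi-commute in [A * B], so the lemmas on
    words rewrite both coordinates with the same scalars. *)
Definition diag (r : R) : (A * B)%type := (iota r, psi (phi r)).
Fact diag_is_zmod : zmod_morphism diag.
Proof. by move=> r s; rewrite /diag !rmorphB. Qed.
Fact diag_is_monoid : monoid_morphism diag.
Proof. by split=> [|r s]; rewrite /diag ?rmorph1 // !rmorphM. Qed.
HB.instance Definition _ :=
  GRing.isZmodMorphism.Build R (A * B)%type diag diag_is_zmod.
HB.instance Definition _ :=
  GRing.isMonoidMorphism.Build R (A * B)%type diag diag_is_monoid.

Let z (i : 'I_n) : (A * B)%type := (x i, y i).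

Lemma monomial_pair a : monomial z a = (monomial x a, monomial y a).
Proof.
rewrite [LHS]surjective_pairing /monomial !rmorph_prod.
by congr (_, _); apply: eq_bigr => i _; rewrite rmorphXn.
Qed.

Lemma diag_twisting i : twisting diag (z i).
Proof.
move=> r; have [r' [e r'0]] := PBW_twisting PBW i r; exists r'; split=> //.
by rewrite /z /diag; congr (_, _); [apply: e | apply: y_twist].
Qed.

Lemma diag_qcomm i j : qcomm diag (z i) (z j).
Proof.
have [c [c0 e]] := PBW_qcomm PBW i j; exists c; split=> //.
rewrite mulrA in e; rewrite mulrA.
by rewrite /z /diag; congr (_, _); [apply: e | apply: y_comm].
Qed.

(* The subring of [A * B] generated by the pairs [(iota r, psi (phi r))] and
   [(x i, y i)] is the graph of the comparison map. *)
Definition in_graph (t : (A * B)%type) : Prop :=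
  exists l : seq (R * mexp n), t = \sum_(p <- l) diag p.1 * monomial z p.2.

Lemma in_graph_term r e : in_graph (diag r * monomial z e).
Proof. by exists [:: (r, e)]; rewrite big_seq1. Qed.

Lemma in_graph0 : in_graph 0.
Proof. by exists [::]; rewrite big_nil. Qed.

Lemma in_graphD t u : in_graph t -> in_graph u -> in_graph (t + u).
Proof. by move=> [l ->] [m ->]; exists (l ++ m); rewrite big_cat. Qed.

Lemma in_graphN t : in_graph t -> in_graph (- t).
Proof.
move=> [l ->]; exists (map (fun p => (- p.1, p.2)) l); rewrite big_map -sumrN.
by apply: eq_bigr => p _; rewrite rmorphN mulNr.
Qed.

Lemma in_graphM t u : in_graph t -> in_graph u -> in_graph (t * u).
Proof.
move=> [l ->] [m ->]; rewrite mulr_suml.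
apply: (big_ind in_graph in_graph0 in_graphD) => p _; rewrite mulr_sumr.
apply: (big_ind in_graph in_graph0 in_graphD) => q _.
have [r [tw _]] := twisting_monomial diag_twisting p.2 q.1.
have [d [_ md]] := monomial_mul R_Ore diag_twisting diag_qcomm p.2 q.2.
rewrite mulrA -(mulrA (diag p.1)) tw -!mulrA md !mulrA -!rmorphM.
exact: in_graph_term.
Qed.

Lemma pair_sum (l : seq (R * mexp n)) :
  \sum_(p <- l) diag p.1 * monomial z p.2 =
  (\sum_(p <- l) iota p.1 * monomial x p.2,
   \sum_(p <- l) psi (phi p.1) * monomial y p.2).
Proof.
rewrite [LHS]surjective_pairing !rmorph_sum.
by congr (_, _); apply: eq_bigr => p _; rewrite monomial_pair.
Qed.

(** A combination of pairs vanishes in one coordinate exactly when it does in the other: both mean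
    that the coefficients in [R] sum to zero at each exponent, as [phi] is injective. One direction
    makes [h] well defined, the other injective. *)
Lemma comparison_morphism : exists h : {rmorphism A -> B},
  [/\ injective h, forall r, h (iota r) = psi (phi r) &
      forall a, h (monomial x a) = monomial y a].
Proof.
have XA := PBW_skew_monomials R_Ore PBW.
have sub (l : seq (R * mexp n)) : {subset map snd l <= undup (map snd l)}.
  by move=> e; rewrite mem_undup.
have coef0 l : \sum_(p <- l) iota p.1 * monomial x p.2 = 0 <->
    \sum_(p <- l) psi (phi p.1) * monomial y p.2 = 0.
  split=> [/(left_free_coef0 (skm_free XA)) c0 | /(left_free_coef0 (proj2 y_basis)) c0].
    rewrite (sum_by_exponent (psi \o phi : {rmorphism R -> B}) _ _
      (undup_uniq _) (@sub l)).
    by rewrite big1 // => e _; rewrite c0 rmorph0 mul0r.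
  rewrite (sum_by_exponent iota _ _ (undup_uniq _) (@sub l)).
  rewrite big1 // => e _; rewrite (_ : \sum_(_ <- _ | _) _ = 0).
    by rewrite rmorph0 mul0r.
  by apply: phi_inj; rewrite rmorph_sum c0 rmorph0.
have graph0 a b : in_graph (a, b) -> (a = 0 <-> b = 0).
  by move=> [l]; rewrite pair_sum => -[-> ->].
have graphB a b a' b' :
    in_graph (a, b) -> in_graph (a', b') -> in_graph (a - a', b - b').
  by move=> Gab Gab'; apply: in_graphD Gab (in_graphN Gab').
have [|||a|b /graph0[]|h hG] := @graph_morphism A B (fun a b => in_graph (a, b)).
- exists [:: (1, [ffun=> 0%N])]; rewrite big_seq1 monomial_pair !monomial0.
  by rewrite rmorph1 mul1r.
- exact: graphB.
- by move=> a b a' b'; apply: in_graphM.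
- have [s [c ->]] := skm_span XA a.
  exists (\sum_(e <- s) psi (phi (c e)) * monomial y e).
  by exists [seq (c e, e) | e <- s]; rewrite pair_sum !big_map.
- by move=> b0 _; apply: b0.
have hE a b : in_graph (a, b) -> h a = b.
  by move=> Gab; apply/subr0_eq/(graph0 _ _ (graphB _ _ _ _ (hG a) Gab))/subrr.
exists h; split=> [a a' haa' | r | a].
- apply/subr0_eq/(graph0 _ _ (graphB _ _ _ _ (hG a) (hG a'))).
  by rewrite haa' subrr.
- apply: hE; have := in_graph_term r [ffun=> 0%N].
  by rewrite monomial_pair !monomial0 mulr1.
by apply: hE; have := in_graph_term 1 a; rewrite monomial_pair rmorph1 mul1r.
Qed.

End Comparison.

(** * The left-hand statement *)

Section LeftPart.
Variables (R A : nzRingType) (iota : {rmorphism R -> A}) (n : nat) (x : 'I_n -> A).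
Hypotheses (R_Ore : left_Ore_domain R) (PBW : qc_skew_PBW iota x).

Lemma PBW_left_Ore_domain : left_Ore_domain A.
Proof. exact: skm_left_Ore_domain R_Ore (PBW_skew_monomials R_Ore PBW). Qed.

Lemma PBW_iota_neq0 s : s != 0 -> iota s != 0.
Proof.
by case: PBW => inj _ _ _; apply: contra_neq => s0; apply: inj; rewrite s0 rmorph0.
Qed.

Lemma PBW_left_fractions (K : unitRingType) (phi : {rmorphism R -> K})
    (B : nzRingType) (psi : {rmorphism K -> B}) (y : 'I_n -> B) :
  left_fractions phi -> left_bar_extension iota x phi psi y ->
  (exists (Q' : unitRingType) (f' : {rmorphism B -> Q'}), left_fractions f') /\
  (forall (Q Q' : unitRingType) (f : {rmorphism A -> Q})
      (f' : {rmorphism B -> Q'}),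
    left_fractions f -> left_fractions f' -> ring_iso Q Q').
Proof.
move=> phiK [_ y_basis tw cm]; have [_ [phi_inj fracK]] := phiK.
have phiU s : s != 0 -> phi s \is a GRing.unit by apply: left_fractions_unit.
have [|h [h_inj h_iota h_mon]] :=
    comparison_morphism R_Ore PBW phi_inj y_basis _ cm.
  move=> i r r' e.
  (* Denominator [1] specializes the rule for fractions to scalars from [R]. *)
  have := tw i 1 r 1 r' (oner_neq0 _); rewrite !rmorph1 !invr1 !mul1r mulr1.
  by apply.
apply: (left_fractions_transfer (h := h) PBW_left_Ore_domain h_inj) => u.
(* A denominator from [R] becomes a unit in [K], so its image in [B] is cancellable. *)
suff [s [a [s0 su]]] : exists s a, s != 0 /\ psi (phi s) * u = h a.
  exists (iota s), a; rewrite PBW_iota_neq0 // h_iota; split=> // w sw0.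
  by rewrite -[w]mul1r -(rmorph1 psi) -(mulVr (phiU s s0)) rmorphM -mulrA sw0 mulr0.
have [S [c ->]] := proj1 y_basis u.
pose P v := exists s a, s != 0 /\ psi (phi s) * v = h a.
rewrite /lcomb; apply: (big_ind P) => [|v1 v2|e _].
- by exists 1, 0; rewrite oner_neq0 mulr0 rmorph0.
- move=> [s1 [a1 [s10 e1]]] [s2 [a2 [s20 e2]]].
  have [t [b [t0 ts]]] := Ore_mult R_Ore s1 s20.
  exists (t * s1), (iota t * a1 + iota b * a2).
  rewrite (domain_mulf_neq0 R_Ore) //; split=> //.
  rewrite mulrDr {2}ts !rmorphM -!mulrA e1 e2.
  by rewrite rmorphD !rmorphM !h_iota.
have [s [r [s0 ->]]] := fracK (c e); exists s, (iota r * monomial x e).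
by rewrite mulrA -rmorphM mulrA divrr ?phiU // mul1r rmorphM h_iota h_mon.
Qed.

End LeftPart.

(** * The right-hand statement *)

Section RightPart.
Variables (R A : nzRingType) (iota : {rmorphism R -> A}) (n : nat) (x : 'I_n -> A).
Hypotheses (R_Ore : left_Ore_domain R) (PBW : qc_skew_PBW iota x).
Hypotheses (R_rOre : right_Ore_domain R).
Hypothesis x_bij : forall i, sigma_bijective iota x i.

Lemma PBW_untwisting_monomial a : untwisting iota (monomial x a).
Proof.
apply: untwisting_monomial => i; exact (PBW_untwisting R_Ore PBW (@x_bij i)).
Qed.

Lemma PBW_right_Ore_domain : right_Ore_domain A.
Proof.
apply/right_Ore_domainP/(skm_left_Ore_domain (proj1 (right_Ore_domainP R) R_rOre)).
apply: skew_monomials_conv; first exact: R_Ore.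
  exact: PBW_skew_monomials R_Ore PBW.
exact: PBW_untwisting_monomial.
Qed.

Lemma PBW_right_fractions (K : unitRingType) (phi : {rmorphism R -> K})
    (B : nzRingType) (psi : {rmorphism K -> B}) (y : 'I_n -> B) :
  right_fractions phi -> right_tilde_extension iota x phi psi y ->
  (exists (Q' : unitRingType) (f' : {rmorphism B -> Q'}), right_fractions f') /\
  (forall (Q Q' : unitRingType) (f : {rmorphism A -> Q})
      (f' : {rmorphism B -> Q'}),
    right_fractions f -> right_fractions f' -> ring_iso Q Q').
Proof.
move=> [Kdiv [phi_inj fracK]] [_ y_basis tw cm].
have phiU s : s != 0 -> phi s \is a GRing.unit.
  by move=> s0; apply: Kdiv; rewrite -(rmorph0 phi) (inj_eq phi_inj).
have [|h [h_inj h_iota h_mon]] :=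
    comparison_morphism R_Ore PBW phi_inj y_basis _ cm.
  move=> i r r' e.
  have := tw i 1 r 1 r' (oner_neq0 _); rewrite !rmorph1 !invr1 !mulr1 !mul1r.
  by apply.
apply: (right_fractions_transfer (h := h) PBW_right_Ore_domain h_inj) => u.
suff [s [a [s0 su]]] : exists s a, s != 0 /\ u * psi (phi s) = h a.
  exists (iota s), a; rewrite (PBW_iota_neq0 PBW) // h_iota; split=> // w sw0.
  by rewrite -[w]mulr1 -(rmorph1 psi) -(divrr (phiU s s0)) rmorphM mulrA sw0 mul0r.
have [S [c ->]] := proj1 y_basis u.
pose P v := exists s a, s != 0 /\ v * psi (phi s) = h a.
rewrite /lcomb; apply: (big_ind P) => [|v1 v2|e _].
- by exists 1, 0; rewrite oner_neq0 mul0r rmorph0.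
- move=> [s1 [a1 [s10 e1]]] [s2 [a2 [s20 e2]]].
  have [b [t [t0 ts]]] := proj2 R_rOre s1 s2 s20.
  exists (s1 * t), (a1 * iota t + a2 * iota b).
  rewrite (domain_mulf_neq0 R_Ore) //; split=> //.
  rewrite mulrDl {2}ts !rmorphM !mulrA e1 e2.
  by rewrite rmorphD !rmorphM !h_iota.
have [s [r [s0 ->]]] := fracK (c e).
(* The denominator [s] stands to the left of the monomial but has to be cleared from the right; [s']
   is what becomes [s] after crossing it. *)
have [s' es'] := PBW_untwisting_monomial e s.
have s'0 : s' != 0.
  apply: contraNneq s0 => s'0.
  apply/eqP/(left_free_inj (skm_free (PBW_skew_monomials R_Ore PBW)) (e := e)).
  by rewrite -es' s'0 !rmorph0 mulr0 mul0r.
exists s', (iota r * monomial x e); split=> //.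
have := congr1 h es'; rewrite !rmorphM !h_iota h_mon => {}es'.
by rewrite -mulrA es' mulrA -!(rmorphM psi) divrK ?phiU.
Qed.

End RightPart.

Theorem theorem3p5 (R A : nzRingType) (iota : {rmorphism R -> A})
  (n : nat) (x : 'I_n -> A) :
  left_Ore_domain R -> qc_skew_PBW iota x ->
  (* left part *)
  (left_Ore_domain A /\
   (exists (Q : unitRingType) (f : {rmorphism A -> Q}), left_fractions f) /\
   (forall (K : unitRingType) (phi : {rmorphism R -> K})
           (B : nzRingType) (psi : {rmorphism K -> B}) (y : 'I_n -> B),
      left_fractions phi -> left_bar_extension iota x phi psi y ->
      (exists (Q' : unitRingType) (f' : {rmorphism B -> Q'}), left_fractions f') /\
      (forall (Q Q' : unitRingType) (f : {rmorphism A -> Q})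
              (f' : {rmorphism B -> Q'}),
         left_fractions f -> left_fractions f' -> ring_iso Q Q'))) /\
  (* right part *)
  (right_Ore_domain R -> (forall i : 'I_n, sigma_bijective iota x i) ->
   right_Ore_domain A /\
   (exists (Q : unitRingType) (f : {rmorphism A -> Q}), right_fractions f) /\
   (forall (K : unitRingType) (phi : {rmorphism R -> K})
           (B : nzRingType) (psi : {rmorphism K -> B}) (y : 'I_n -> B),
      right_fractions phi -> right_tilde_extension iota x phi psi y ->
      (exists (Q' : unitRingType) (f' : {rmorphism B -> Q'}), right_fractions f') /\
      (forall (Q Q' : unitRingType) (f : {rmorphism A -> Q})
              (f' : {rmorphism B -> Q'}),
         right_fractions f -> right_fractions f' -> ring_iso Q Q'))).
Proof.
move=> R_Ore PBW; split.
  have A_Ore := PBW_left_Ore_domain R_Ore PBW.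
  split=> //; split; first exact: left_fractions_exist.
  by move=> K phi B psi y; apply: PBW_left_fractions.
move=> R_rOre x_bij.
have A_rOre := PBW_right_Ore_domain R_Ore PBW R_rOre x_bij.
split=> //; split; first exact: right_fractions_exist.
by move=> K phi B psi y; apply: PBW_right_fractions.
Qed.
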